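(* Let $K=K_*\ge 2$ be the true (known) number of communities, $Z_*\in\mathcal M_{n,K}$ the true clustering matrix, and suppose Assumption A1 holds. Let $\hat Z$ be a solution (for this fixed $K$) of $$\min_{Z\in\mathcal M_{n,K},\,J}\Big\{\sum_{k,l=1}^K\big\|A^{(k,l)}(Z,K)-\Pi_{(1)}\big(\Pi_{J^{(k,l)}}(A^{(k,l)}(Z,K))\big)\big\|_F^2+\mathrm{Pen}(n,J,K)\Big\},$$ where $J$ ranges over sparsity families for $(Z,K)$ and $\mathrm{Pen}$ is one of the penalties $\mathrm{Pen}^{(s)}$, $\mathrm{Pen}^{(ns)}$ (with fixed constants $\beta_1,\beta_2>0$). There are absolute positive constants $H_1,H_2$, independent of $K,n,t,J_*,\breve J_*(Z),\delta_n,\alpha_n$, such that: if for some $\alpha_n\in(0,1/2)$, $\delta_n\in(0,1)$ and $t>0$, $$\|P_*\|_F^2\ge\max_{Z\in\Upsilon(Z_*,\delta_n)}\Big[(1+\alpha_n)\sum_{k,l=1}^K\|P_*^{(k,l)}(Z)\|_{op}^2+\frac{H_1}{\alpha_n}|\breve J_*(Z)|\ln\Big(\frac{nKe}{|\breve J_*(Z)|}\Big)\Big]+\frac{H_1}{\alpha_n}\big(|J_*|+n\ln K+t\big)+H_2|J_*|\ln\Big(\frac{nKe}{|J_*|}\Big),$$ then, with probability at least $1-2e^{-t}$, the proportion of nodes misclassified by $\hat Z$, namely $(2n)^{-1}\min_{\mathscr P_K\in\mathcal P_K}\|\hat Z\mathscr P_K-Z_*\|_1$, is at most $\delta_n$.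
   Context: Network model: $A\in\{0,1\}^{n\times n}$ symmetric, $A_{ij}\sim\mathrm{Bernoulli}((P_* )_{ij})$ independent for $1\le i\le j\le n$, $A_{ji}=A_{ij}$, $P_*$ symmetric. $\mathcal M_{n,K}$: matrices $Z\in\{0,1\}^{n\times K}$ with one $1$ per row, $Z_{ik}=1$ iff node $i\in\mathcal N_k$, $Z^TZ=\mathrm{diag}(n_1,\dots,n_K)$, $n_k=|\mathcal N_k|$. $\mathscr P_{Z,K}$ is the permutation matrix reordering nodes by community; $B(Z,K)=\mathscr P_{Z,K}^TB\mathscr P_{Z,K}$ and $B^{(k,l)}(Z)=B^{(k,l)}(Z,K)\in\mathbb R^{n_k\times n_l}$ is its $(k,l)$ block (rows: nodes of $\mathcal N_k$, columns: nodes of $\mathcal N_l$). True model: $P_*^{(k,l)}(Z_* )=\Lambda_*^{(k,l)}(\Lambda_*^{(l,k)})^T$ where $\Lambda_*\in[0,1]^{n\times K}$ has column $l$ split into blocks $\Lambda_*^{(k,l)}\in[0,1]^{n_k}$ indexed by the nodes of community $k$ of $Z_*$. Assumption A1: for every $k$, the vectors $\Lambda_*^{(k,1)},\dots,\Lambda_*^{(k,K)}$ are linearly independent. $(J_* )_{k,l}=\{i:(\Lambda_*^{(k,l)})_i\ne0\}$, $|J_*|=\sum_{k,l}|(J_* )_{k,l}|$ (number of nonzero entries of $\Lambda_*$). For $Z\in\mathcal M_{n,K}$: $(\breve J_* )_{k,l}(Z)=\{i\in\mathcal N_k: (P_*^{(k,l)}(Z))_{ij}\neq0 \text{ for some } j\}$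 and $|\breve J_*(Z)|=\sum_{k,l}|(\breve J_* )_{k,l}(Z)|$. A sparsity family for $(Z,K)$ is $J=(J_{k,l})$ with $J_{k,l}\subseteq\mathcal N_k$, $J^{(k,l)}=J_{k,l}\times J_{l,k}$, $|J|=\sum|J_{k,l}|$; $\Pi_{J^{(k,l)}}(X)$ sets entries of $X$ outside $J^{(k,l)}$ to zero; $\Pi_{(1)}(X)$ is the best rank-one approximation of $X$. Penalties (convention $0\ln(c/0)=0$): $\mathrm{Pen}^{(s)}=\beta_1\sum_{k,l}|J_{k,l}|\ln(n_ke/|J_{k,l}|)+\beta_2K\sum_k\ln n_k+\beta_2(n\ln K+\ln n)$; $\mathrm{Pen}^{(ns)}=\beta_1|J|\ln(nKe/|J|)+2\beta_2\ln n+\beta_2(n\ln K+\ln n)$. $\mathcal P_K$ is the set of $K\times K$ permutation matrices, and $\Upsilon(Z_*,\delta_n)=\{Z\in\mathcal M_{n,K}:(2n)^{-1}\min_{\mathscr P_K\in\mathcal P_K}\|Z\mathscr P_K-Z_*\|_1\ge\delta_n\}$; $\|\cdot\|_1$ is the entrywise $\ell_1$ norm. *)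

(* Defs.v *)
From HB Require Import structures.
From mathcomp Require Import all_boot all_order all_algebra all_fingroup.
From mathcomp Require Import boolp classical_sets reals sequences exp.
Set Implicit Arguments. Unset Strict Implicit. Unset Printing Implicit Defensive.
Import Order.TTheory GRing.Theory Num.Theory.
Local Open Scope ring_scope.

Section Defs.
Variable R : realType.
Variables n K : nat.

(* A clustering Z in M_{n,K}, represented by its label map i |-> k with Z_{ik}=1. *)
Definition labels := {ffun 'I_n -> 'I_K}.

Definition Zmat (z : labels) : 'M[R]_(n, K) := \matrix_(i, k) (z i == k)%:R.

Definition comm (z : labels) (k : 'I_K) : {set 'I_n} := [set i | z i == k].
Definition csize (z : labels) (k : 'I_K) : R := (#|comm z k|)%:R.

(* The (k,l) block B^{(k,l)}(Z) of B(Z,K), represented as the n x n matrix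
   equal to B on N_k x N_l and to 0 elsewhere (zero padding; all norms/ranks
   used below are invariant under this padding and under permutation). *)
Definition blk (z : labels) (k l : 'I_K) (B : 'M[R]_n) : 'M[R]_n :=
  \matrix_(i, j) (if (z i == k) && (z j == l) then B i j else 0).

Definition sfamily (z : labels) (J : 'I_K -> 'I_K -> {set 'I_n}) : Prop :=
  forall k l, J k l \subset comm z k.

Definition card_fam (J : 'I_K -> 'I_K -> {set 'I_n}) : R :=
  \sum_(k < K) \sum_(l < K) (#|J k l|)%:R.

Definition projJ (J : 'I_K -> 'I_K -> {set 'I_n}) (k l : 'I_K) (X : 'M[R]_n)
  : 'M[R]_n :=
  \matrix_(i, j) (if (i \in J k l) && (j \in J l k) then X i j else 0).

Definition frob2 (m p : nat) (X : 'M[R]_(m, p)) : R :=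
  \sum_(i < m) \sum_(j < p) X i j ^+ 2.

Definition vnorm (v : 'cV[R]_n) : R := Num.sqrt (\sum_(i < n) v i 0 ^+ 2).

Definition opnorm (X : 'M[R]_n) : R :=
  sup [set vnorm (X *m v) | v in [set v : 'cV[R]_n | vnorm v <= 1]].

Definition best_rank1 (pi1 : 'M[R]_n -> 'M[R]_n) : Prop :=
  forall X : 'M[R]_n, (\rank (pi1 X) <= 1)%N /\
    forall Y : 'M[R]_n, (\rank Y <= 1)%N -> frob2 (X - pi1 X) <= frob2 (X - Y).

Definition xlog (a c : R) : R := if a == 0 then 0 else a * ln (c / a).

Definition pen_s (b1 b2 : R) (z : labels) (J : 'I_K -> 'I_K -> {set 'I_n}) : R :=
  b1 * (\sum_(k < K) \sum_(l < K) xlog (#|J k l|)%:R (csize z k * expR 1))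
  + b2 * K%:R * (\sum_(k < K) ln (csize z k))
  + b2 * (n%:R * ln K%:R + ln n%:R).

Definition pen_ns (b1 b2 : R) (J : 'I_K -> 'I_K -> {set 'I_n}) : R :=
  b1 * xlog (card_fam J) (n%:R * K%:R * expR 1)
  + 2 * b2 * ln n%:R
  + b2 * (n%:R * ln K%:R + ln n%:R).

Definition pen (sparse : bool) (b1 b2 : R) (z : labels)
  (J : 'I_K -> 'I_K -> {set 'I_n}) : R :=
  if sparse then pen_s b1 b2 z J else pen_ns b1 b2 J.

Definition objective (pi1 : 'M[R]_n -> 'M[R]_n) (sparse : bool) (b1 b2 : R)
  (A : 'M[R]_n) (z : labels) (J : 'I_K -> 'I_K -> {set 'I_n}) : R :=
  \sum_(k < K) \sum_(l < K) frob2 (blk z k l A - pi1 (projJ J k l (blk z k l A)))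
  + pen sparse b1 b2 z J.

Definition is_solution (pi1 : 'M[R]_n -> 'M[R]_n) (sparse : bool) (b1 b2 : R)
  (A : 'M[R]_n) (zh : labels) : Prop :=
  exists Jh, sfamily zh Jh /\
    forall z J, sfamily z J ->
      objective pi1 sparse b1 b2 A zh Jh <= objective pi1 sparse b1 b2 A z J.

Definition l1 (m p : nat) (X : 'M[R]_(m, p)) : R :=
  \sum_(i < m) \sum_(j < p) `|X i j|.

Definition misclass (z zs : labels) : R :=
  (2 * n%:R)^-1 *
  \big[Num.min/l1 (Zmat z *m perm_mx (1 : 'S_K) - Zmat zs)]_(s : 'S_K)
     l1 (Zmat z *m perm_mx s - Zmat zs).

Definition cardJstar (zs : labels) (Lam : 'M[R]_(n, K)) : R :=
  \sum_(k < K) \sum_(l < K) (#|[set i | (zs i == k) && (Lam i l != 0)]|)%:R.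

Definition cardJbreve (P : 'M[R]_n) (z : labels) : R :=
  \sum_(k < K) \sum_(l < K)
    (#|[set i | (z i == k) && [exists j, (z j == l) && (P i j != 0)]]|)%:R.

Definition A1 (zs : labels) (Lam : 'M[R]_(n, K)) : Prop :=
  forall k : 'I_K, forall c : 'I_K -> R,
    (forall i, zs i == k -> \sum_(l < K) c l * Lam i l = 0) ->
    forall l, c l = 0.

(* Random symmetric adjacency matrix: A_{ij} ~ Bernoulli(P_{ij}) independent
   for i <= j, A_{ji} = A_{ij}.  Sample space: boolean n x n matrices;
   non-symmetric ones have weight 0. *)
Definition Amat (a : 'M[bool]_n) : 'M[R]_n := \matrix_(i, j) (a i j)%:R.

Definition weight (P : 'M[R]_n) (a : 'M[bool]_n) : R :=
  if a^T == a then
    \prod_(i < n) \prod_(j < n | (i <= j)%N) (if a i j then P i j else 1 - P i j)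
  else 0.

Definition Prob (P : 'M[R]_n) (E : pred 'M[bool]_n) : R :=
  \sum_(a : 'M[bool]_n | E a) weight P a.

End Defs.

(* Main.v *)
(** Write Xi = A - P.  Comparing the objective at the estimator with its value at
the true clustering, where the blocks of P have rank one, gives
  |P|_F^2 + 2 <Xi, P> <= sum_kl (u_kl^T A^(k,l)(Z) v_kl)^2 + Pen(J_star) - Pen(J)
for unit vectors u_kl, v_kl spanning the fitted rank-one blocks: subtracting a
rank-one matrix lowers the squared Frobenius norm by at most the square of a
unit bilinear form.  Splitting A = P + Xi, the P part is at most
(1 + alpha/2) sum_kl |P^(k,l)(Z)|_op^2, so it remains to bound, uniformly in Z,
the noise sum_kl (u_kl^T Xi^(k,l)(Z) v_kl)^2 by a multiple of
|Jbreve(Z)| + n ln K + t.  No penalty is needed for that: almost surely A, hence Xi,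
vanishes where P does, so only |Jbreve(Z)| coordinates of the vectors matter.  The
sum of squares is the square of a supremum of <Xi, T> over
T_ij = a_(i, z_j) v_(j, z_i) with a in a ball and v in a product of balls; an integer
lattice gives a net of size exp(O(|Jbreve(Z)|)), and sub-Gaussian tails with a union
bound over Z and the net conclude.  The penalty difference is controlled by the
log-sum inequality. *)
Require Import Defs.
From HB Require Import structures.
From mathcomp Require Import all_boot all_order all_algebra all_fingroup.
From mathcomp Require Import boolp classical_sets reals sequences exp.
From mathcomp Require Import lra ring zify.
Import Order.TTheory GRing.Theory Num.Theory.
Local Open Scope ring_scope.
Set Implicit Arguments.
Unset Strict Implicit.
Unset Printing Implicit Defensive.

(** * Exponential moments of a centred Bernoulli variable *)

Lemma expR_le_addsqr (R : realType) (x : R) : expR x <= x + expR (2 * x ^+ 2).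
Proof.
have h2 : 1 + 2 * x ^+ 2 <= expR (2 * x ^+ 2) by exact: expR_ge1Dx.
have hN : 1 - x <= expR (- x) by have := expR_ge1Dx (- x).
have h0 := expR_gt0 x.
have hM : expR x * expR (- x) = 1 by rewrite expRN mulfV ?gt_eqF.
have [x0|x0] := ltP x 0.
  have : expR x <= (1 - x)^-1.
    rewrite -[expR x]invrK lef_pV2 ?posrE ?invr_gt0; [|exact: expR_gt0|lra].
    by rewrite -expRN.
  suff : (1 - x)^-1 <= 1 + x + x ^+ 2 by nra.
  rewrite -[(1 - x)^-1]mul1r ler_pdivrMr; last lra.
  suff : 0 <= - x ^+ 3 by lra.
  by rewrite exprS; nra.
have [x1|x1] := leP (2^-1) x.
  have : expR x <= expR (2 * x ^+ 2) by rewrite ler_expR; nra.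
  by lra.
(* On [0, 1/2) one has (1 - x)(1 + x + 2x^2) = 1 + x^2 (1 - 2x) >= 1; this is where the constant 2
   in the exponent enters. *)
have : expR x <= (1 - x)^-1.
  rewrite -[expR x]invrK lef_pV2 ?posrE ?invr_gt0; [|exact: expR_gt0|lra].
  by rewrite -expRN.
suff : (1 - x)^-1 <= 1 + x + 2 * x ^+ 2 by lra.
rewrite -[(1 - x)^-1]mul1r ler_pdivrMr; last lra.
by nra.
Qed.

(** The linear terms supplied by [expR_le_addsqr] at the two outcomes cancel because the variable is
    centred; only the quadratic exponentials remain. *)
Lemma bernoulli_mgf (R : realType) (p s : R) : 0 <= p <= 1 ->
  p * expR ((1 - p) * s) + (1 - p) * expR (- p * s) <= expR (2 * s ^+ 2).
Proof.
case/andP=> p0 p1.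
have h (y : R) : 0 <= y <= 1 -> expR (2 * (y * s) ^+ 2) <= expR (2 * s ^+ 2).
  case/andP=> y0 y1; rewrite ler_expR exprMn.
  have : y ^+ 2 <= 1 by rewrite expr_le1.
  by have := sqr_ge0 s; nra.
have ha := expR_le_addsqr ((1 - p) * s).
have hb := expR_le_addsqr (- p * s).
have ha' : expR (2 * ((1 - p) * s) ^+ 2) <= expR (2 * s ^+ 2) by apply: h; lra.
have hb' : expR (2 * (- p * s) ^+ 2) <= expR (2 * s ^+ 2).
  by rewrite mulNr sqrrN; apply: h; lra.
by nra.
Qed.

(** A symmetric matrix is determined by its entries with [i <= j], so the sum can be reindexed by
    functions that are [false] below the diagonal and distributivity applies. This encodes the
    independence of these entries. *)
Lemma sum_sym_prod (R : comNzRingType) n (h : 'I_n -> 'I_n -> bool -> R) :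
  \sum_(a : 'M[bool]_n | a^T == a)
     \prod_(i < n) \prod_(j < n | (i <= j)%N) h i j (a i j) =
  \prod_(i < n) \prod_(j < n | (i <= j)%N) (h i j true + h i j false).
Proof.
have -> : \prod_(i < n) \prod_(j < n | (i <= j)%N) (h i j true + h i j false) =
    \prod_(p : 'I_n * 'I_n | (p.1 <= p.2)%N) \sum_(b : bool) h p.1 p.2 b.
  by rewrite pair_big_dep; apply: eq_bigr => p _; rewrite big_bool.
rewrite (big_distr_big_dep false (fun p : 'I_n * 'I_n => (p.1 <= p.2)%N)
  (fun _ => predT) (fun p b => h p.1 p.2 b)).
pose toM (f : {ffun 'I_n * 'I_n -> bool}) : 'M[bool]_n :=
  \matrix_(i, j) (if (i <= j)%N then f (i, j) else f (j, i)).
pose ofM (a : 'M[bool]_n) : {ffun 'I_n * 'I_n -> bool} :=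
  [ffun p : 'I_n * 'I_n => (p.1 <= p.2)%N && a p.1 p.2].
have symM (a : 'M[bool]_n) : a^T == a -> forall i j, a i j = a j i.
  by move=> /eqP aT i j; rewrite -{1}aT mxE.
rewrite (reindex_onto toM ofM) /=; last first.
  move=> a /symM sa; apply/matrixP => i j; rewrite mxE !ffunE /=.
  have [//|ltji] := leqP i j.
  by rewrite (ltnW ltji) /= sa.
apply: eq_big => [f|f _].
  have -> : (toM f)^T == toM f.
    apply/eqP/matrixP => i j; rewrite !mxE.
    case: (ltngtP i j) => // /val_inj -> //.
  rewrite /=; apply/eqP/pfamilyP => [<-|[supp _]].
    split=> //; by apply/supportP => p; rewrite unfold_in /= ffunE => /negbTE -> //.
  apply/ffunP => p; rewrite ffunE mxE.
  case: ifP => /= hp; first by case: (p).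
  by move/supportP: supp => /(_ p); rewrite unfold_in /= hp => ->.
rewrite pair_big_dep /=; apply: eq_bigr => p hp.
by rewrite mxE hp; case: (p).
Qed.

(** * The law of the adjacency matrix and sub-Gaussian tails of the noise *)

Section Probability.
Variables (R : realType) (n : nat) (P : 'M[R]_n).
Hypothesis P01 : forall i j, 0 <= P i j <= 1.
Hypothesis Psym : forall i j, P i j = P j i.

Lemma weight_ge0 a : 0 <= weight P a.
Proof.
rewrite /weight; case: ifP => // _.
apply: prodr_ge0 => i _; apply: prodr_ge0 => j _.
by have /andP[? ?] := P01 i j; case: ifP => _ //; rewrite subr_ge0.
Qed.

Lemma weight_sum1 : \sum_a weight P a = 1.
Proof.
rewrite /weight -big_mkcond /=.
rewrite (sum_sym_prod (fun i j (b : bool) => if b then P i j else 1 - P i j)) /=.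
apply: big1 => i _; apply: big1 => j _; ring.
Qed.

(** An edge with [P i j = 0] brings a zero factor into the weight. This confines the noise to the
    support of [P]. *)
Lemma weight_supp a : weight P a != 0 ->
  a^T = a /\ forall i j, a i j -> P i j != 0.
Proof.
rewrite /weight; case: ifP => [/eqP aT|]; last by rewrite eqxx.
have sa i j : a i j = a j i by rewrite -{1}aT mxE.
move=> w0; split => //.
have up (i j : 'I_n) : (i <= j)%N -> a i j -> P i j != 0.
  move=> ij aij; apply/eqP => Pij; move/negP: w0; apply.
  rewrite prodf_seq_eq0; apply/hasP; exists i; first by rewrite mem_index_enum.
  rewrite /= prodf_seq_eq0; apply/hasP; exists j; first by rewrite mem_index_enum.
  by rewrite ij aij Pij eqxx.
move=> i j; have [/up //|/ltnW ji] := leqP i j.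
by rewrite sa Psym; exact: up.
Qed.

Lemma Prob_markov (E : pred 'M[bool]_n) (f : 'M[bool]_n -> R) :
  (forall a, weight P a != 0 -> E a -> 0 <= f a) ->
  Prob P E <= \sum_a weight P a * expR (f a).
Proof.
move=> Ef; rewrite /Prob [leRHS](bigID E) /= -[leLHS]addr0; apply: lerD.
  apply: ler_sum => a Ea.
  have [->|w0] := eqVneq (weight P a) 0; first by rewrite mul0r.
  rewrite ler_peMr ?weight_ge0 //.
  by rewrite -(expR0 R) ler_expR Ef.
by apply: sumr_ge0 => a _; rewrite mulr_ge0 ?weight_ge0 ?expR_ge0.
Qed.

Lemma Prob_sub (E E' : pred 'M[bool]_n) :
  (forall a, weight P a != 0 -> E a -> E' a) -> Prob P E <= Prob P E'.
Proof.
move=> EE'; rewrite /Prob !(big_mkcond _ (weight P)).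
apply: ler_sum => a _; case Ea: (E a); last by case: ifP => // _; exact: weight_ge0.
have [->|w0] := eqVneq (weight P a) 0; first by rewrite if_same.
by rewrite EE'.
Qed.

Lemma Prob_exists (I : finType) (D : pred I) (E : I -> pred 'M[bool]_n) :
  Prob P (fun a => [exists i, D i && E i a]) <= \sum_(i | D i) Prob P (E i).
Proof.
rewrite /Prob [leRHS](exchange_big_dep predT) //= big_mkcond ler_sum // => a _.
rewrite sumr_const -mulr_natl; case: ifP => [/existsP [i /andP[Di Ei]]|_].
  rewrite ler_peMl ?weight_ge0 // ler1n; apply/card_gt0P; exists i.
  by rewrite unfold_in /= Di.
by rewrite mulr_ge0 ?weight_ge0.
Qed.

Definition inner (m p : nat) (X Y : 'M[R]_(m, p)) : R :=
  \sum_(i < m) \sum_(j < p) X i j * Y i j.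

Lemma sum_upper (g : 'I_n -> 'I_n -> R) :
  \sum_(i < n) \sum_(j < n) g i j =
  \sum_(i < n) \sum_(j < n | (i <= j)%N) (if i == j then g i j else g i j + g j i).
Proof.
transitivity (\sum_(i < n) \sum_(j < n | (i <= j)%N) g i j +
              \sum_(i < n) \sum_(j < n | (i <= j)%N) (if i == j then 0 else g j i)); last first.
  rewrite -big_split /=; apply: eq_bigr => i _; rewrite -big_split /=.
  by apply: eq_bigr => j _; case: eqP => _; rewrite ?addr0.
rewrite [X in _ + X](exchange_big_dep predT) //= -big_split /=.
apply: eq_bigr => i _; rewrite (bigID (fun j : 'I_n => (i <= j)%N)) /=; congr (_ + _).
rewrite [LHS]big_mkcond [RHS]big_mkcond; apply: eq_bigr => j _.
rewrite -ltnNge -val_eqE /=; case: ltngtP => //.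
Qed.

(** Folded onto the independent entries, an off-diagonal one carries [T i j + T j i]; 2(x + y)^2 <=
    4(x^2 + y^2) turns the Bernoulli constant 2 into 4. *)
Lemma noise_mgf (T : 'M[R]_n) :
  \sum_a weight P a * expR (inner (Amat R a - P) T) <= expR (4 * frob2 T).
Proof.
pose S i j := if i == j then T i j else T i j + T j i.
pose h i j (b : bool) := (if b then P i j else 1 - P i j) * expR ((b%:R - P i j) * S i j).
have -> : \sum_a weight P a * expR (inner (Amat R a - P) T) =
   \sum_(a : 'M[bool]_n | a^T == a)
     \prod_(i < n) \prod_(j < n | (i <= j)%N) h i j (a i j).
  rewrite [RHS]big_mkcond; apply: eq_bigr => a _; rewrite /weight.
  case: ifP => [/eqP aT|_]; last by rewrite mul0r.
  have sa i j : a i j = a j i by rewrite -{1}aT mxE.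
  rewrite /inner sum_upper expR_sum -big_split /=; apply: eq_bigr => i _.
  rewrite expR_sum -big_split /=; apply: eq_bigr => j _.
  rewrite /h; congr (_ * expR _); rewrite /S !mxE.
  by case: eqP => // _; rewrite (sa j i) (Psym j i) mulrDr.
rewrite sum_sym_prod.
have -> : expR (4 * frob2 T) = \prod_(i < n) \prod_(j < n | (i <= j)%N)
    expR (4 * (if i == j then T i j ^+ 2 else T i j ^+ 2 + T j i ^+ 2)).
  rewrite /frob2 sum_upper mulr_sumr expR_sum; apply: eq_bigr => i _.
  by rewrite mulr_sumr expR_sum.
apply: ler_prod => i _; apply/andP; split.
  apply: prodr_ge0 => j _.
  have /andP[? ?] := P01 i j.
  by rewrite addr_ge0 // mulr_ge0 ?expR_ge0 ?subr_ge0.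
apply: ler_prod => j _; have /andP[p0 p1] := P01 i j; apply/andP; split.
  by rewrite addr_ge0 // mulr_ge0 ?expR_ge0 ?subr_ge0.
rewrite /h sub0r; apply: le_trans (bernoulli_mgf _ (P01 i j)) _.
rewrite ler_expR /S; case: eqP => _; have := sqr_ge0 (T i j); first by lra.
by have := sqr_ge0 (T i j - T j i); nra.
Qed.

Lemma noise_tail (T : 'M[R]_n) (lam x : R) : 0 <= lam ->
  Prob P (fun a => x <= inner (Amat R a - P) T) <= expR (4 * lam ^+ 2 * frob2 T - lam * x).
Proof.
move=> lam0.
have hl a : inner (Amat R a - P) (lam *: T) = lam * inner (Amat R a - P) T.
  rewrite /inner mulr_sumr; apply: eq_bigr => i _; rewrite mulr_sumr.
  by apply: eq_bigr => j _; rewrite [(lam *: T) i j]mxE mulrCA.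
apply: le_trans (@Prob_markov _ (fun a => inner (Amat R a - P) (lam *: T) - lam * x) _) _.
  by move=> a _ xE; rewrite hl subr_ge0 ler_wpM2l.
under eq_bigr => a _ do rewrite expRD mulrA.
rewrite -mulr_suml expRD ler_wpM2r ?expR_ge0 //.
apply: le_trans (noise_mgf _) _; rewrite ler_expR /frob2.
rewrite le_eqVlt; apply/orP; left; apply/eqP; rewrite -mulrA; congr (_ * _).
rewrite mulr_sumr; apply: eq_bigr => i _; rewrite mulr_sumr; apply: eq_bigr => j _.
by rewrite mxE exprMn.
Qed.

End Probability.

(** * A lattice net for the bilinear form on products of balls *)

Section LatticeNet.
Variables (R : realType) (n K : nat) (z : labels n K).

(** On block (k, l) this is the outer product of column l of [a] and column k of [v], so one pair of
    matrices packs the vectors of all blocks. *)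
Definition bilin (a v : 'M[R]_(n, K)) : 'M[R]_n :=
  \matrix_(i, j) (a i (z j) * v j (z i)).

Definition in_ball (a : 'M[R]_(n, K)) : Prop := frob2 a <= 1.

(** The two constraints differ on purpose: [v] holds one unit vector per block, while [a] also
    absorbs block weights whose squares sum to at most 1, so the supremum of the form is the root of
    a sum of squares. *)
Definition in_block_balls (v : 'M[R]_(n, K)) : Prop :=
  forall k l, \sum_(j | z j == l) v j k ^+ 2 <= 1.

Lemma frob2_bilin a v : in_ball a -> in_block_balls v -> frob2 (bilin a v) <= 1.
Proof.
move=> a1 v1; apply: le_trans a1; apply: ler_sum => i _.
rewrite (partition_big z predT) //=; apply: ler_sum => l _.
rewrite -[leRHS]mulr1; apply: le_trans (ler_wpM2l (sqr_ge0 _) (v1 (z i) l)).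
rewrite mulr_sumr; apply: ler_sum => j /eqP zj.
by rewrite mxE zj exprMn.
Qed.

(** A crude estimate that makes the supremum in [net_bound] finite. *)
Lemma inner_bilin_bound (X : 'M[R]_n) a v : in_ball a -> in_block_balls v ->
  inner X (bilin a v) <= \sum_i \sum_j `|X i j|.
Proof.
move=> a1 v1; apply: ler_sum => i _; apply: ler_sum => j _.
have ha : `|a i (z j)| <= 1.
  rewrite -[leRHS]normr1 -ler_sqr ?nnegrE // !real_normK ?num_real // expr1n.
  apply: le_trans a1; rewrite /frob2 (bigD1 i) //= (bigD1 (z j)) //= -addrA lerDl.
  rewrite addr_ge0 ?sumr_ge0 // => *; first by rewrite sqr_ge0.
  by apply: sumr_ge0 => *; rewrite sqr_ge0.
have hv : `|v j (z i)| <= 1.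
  rewrite -[leRHS]normr1 -ler_sqr ?nnegrE // !real_normK ?num_real // expr1n.
  apply: le_trans (v1 (z i) (z j)); rewrite (bigD1 j) //= lerDl.
  by apply: sumr_ge0 => *; rewrite sqr_ge0.
rewrite mxE; apply: le_trans (ler_norm _) _; rewrite !normrM ler_piMr //.
by rewrite mulr_ile1.
Qed.

Lemma inner_bilinDl X a a' v :
  inner X (bilin (a + a') v) = inner X (bilin a v) + inner X (bilin a' v).
Proof.
rewrite /inner -big_split; apply: eq_bigr => i _; rewrite -big_split.
by apply: eq_bigr => j _; rewrite /= !mxE mulrDl mulrDr.
Qed.

Lemma inner_bilinDr X a v v' :
  inner X (bilin a (v + v')) = inner X (bilin a v) + inner X (bilin a v').
Proof.
rewrite /inner -big_split; apply: eq_bigr => i _; rewrite -big_split.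
by apply: eq_bigr => j _; rewrite /= !mxE !mulrDr.
Qed.

Lemma inner_bilinZl X c a v :
  inner X (bilin (c *: a) v) = c * inner X (bilin a v).
Proof.
rewrite /inner mulr_sumr; apply: eq_bigr => i _; rewrite mulr_sumr.
by apply: eq_bigr => j _; rewrite !mxE; ring.
Qed.

Lemma inner_bilinZr X c a v :
  inner X (bilin a (c *: v)) = c * inner X (bilin a v).
Proof.
rewrite /inner mulr_sumr; apply: eq_bigr => i _; rewrite mulr_sumr.
by apply: eq_bigr => j _; rewrite !mxE; ring.
Qed.

Variable J : {set 'I_n * 'I_K}.

Definition mx_restrict (a : 'M[R]_(n, K)) : 'M[R]_(n, K) :=
  \matrix_(i, l) (if (i, l) \in J then a i l else 0).

Lemma inner_bilin_restrict (X : 'M[R]_n) a v :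
  (forall i j, X i j != 0 -> ((i, z j) \in J) && ((j, z i) \in J)) ->
  inner X (bilin (mx_restrict a) (mx_restrict v)) = inner X (bilin a v).
Proof.
move=> XJ; apply: eq_bigr => i _; apply: eq_bigr => j _.
have [->|/XJ /andP[iJ jJ]] := eqVneq (X i j) 0; first by rewrite !mul0r.
by rewrite !mxE iJ jJ.
Qed.

Lemma sqr_restrict a i l : (mx_restrict a i l) ^+ 2 <= a i l ^+ 2.
Proof. by rewrite mxE; case: ifP => // _; rewrite expr0n sqr_ge0. Qed.

(* A coordinate of the lattice is a sign and an absolute value; the bound
   [4 n K] exceeds every coordinate of the points of [lattice_pts]. *)
Definition lat_coord := (bool * 'I_(4 * (n * K)).+1)%type.

Definition lat_val (c : lat_coord) : R := (-1) ^+ c.1 * c.2%:R.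

Definition lat_coord0 : lat_coord := (false, ord0).

Lemma lat_val0 : lat_val lat_coord0 = 0.
Proof. by rewrite /lat_val mulr0. Qed.

(** Rounding goes towards zero, so that a rounded point never leaves its ball. *)
Lemma lat_coord_round (y : R) : `|y| <= (4 * (n * K))%:R ->
  exists c : lat_coord, `|lat_val c| <= `|y| /\ `|y - lat_val c| <= 1.
Proof.
move=> yN; have y0 := normr_ge0 y.
have /andP[t1 t2] := Num.Theory.truncn_itv y0.
have tN : (Num.trunc `|y| < (4 * (n * K)).+1)%N.
  by rewrite ltnS -(ler_nat R) (le_trans t1).
exists ((y < 0)%R, Ordinal tN); rewrite /lat_val /=.
have -> : `|(-1) ^+ (y < 0)%R * (Num.trunc `|y|)%:R : R| = (Num.trunc `|y|)%:R.
  by rewrite normrM normrX normrN1 expr1n mul1r normr_nat.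
split=> //; rewrite -natr1 in t2; move: t1 t2.
set q : R := (Num.trunc `|y|)%:R => t1 t2.
rewrite ler_norml; case: (ltP y 0) t1 t2 => ys; rewrite ?expr1 ?expr0.
  by rewrite (ltr0_norm ys) => ? ?; apply/andP; split; lra.
by rewrite (ger0_norm ys) => ? ?; apply/andP; split; lra.
Qed.

(** Both meshes below rescale their ball into the Euclidean ball of squared radius 16 |J|, so this
    single set serves both arguments of the form. *)
Definition lattice_pts : {set {ffun 'I_n * 'I_K -> lat_coord}} :=
  [set x : {ffun 'I_n * 'I_K -> lat_coord} | [forall p, (p \in J) || (x p == lat_coord0)] &&
           (\sum_p (x p).2 ^ 2 <= 16 * #|J|)%N].

(** Each sign contributes a geometric series below 2. The resulting 4 = 2^2 per coordinate is the 2
    in the exponent 18 = 16 + 2 of [card_lattice_pts]. *)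
Lemma sum_lat_coord : \sum_(c : lat_coord) (2^-1 : R) ^+ c.2 <= 4.
Proof.
rewrite -(pair_big predT predT (fun (b : bool) (k : 'I_(4 * (n * K)).+1) => (2^-1 : R) ^+ k)) /=.
rewrite big_bool /=.
have geo N : \sum_(k < N) (2^-1 : R) ^+ k <= 2 - 2 * 2^-1 ^+ N.
  elim: N => [|N IH]; first by rewrite big_ord0 expr0; lra.
  by rewrite big_ord_recr /= exprS; lra.
have := geo (4 * (n * K)).+1.
have : 0 <= (2^-1 : R) ^+ (4 * (n * K)).+1 by apply: exprn_ge0; lra.
by lra.
Qed.

(* Since [k <= k ^ 2], weighting a point [x] by the product of the [2 ^ - |x p|]
   bounds the count by a product of geometric series. *)
Lemma card_lattice_pts : #|lattice_pts|%:R <= (2 : R) ^+ (18 * #|J|).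
Proof.
pose Q (p : 'I_n * 'I_K) : pred lat_coord := fun c => (p \in J) || (c == lat_coord0).
have h1 (x : {ffun 'I_n * 'I_K -> lat_coord}) : x \in lattice_pts ->
    1 <= (2 : R) ^+ (16 * #|J|) * \prod_p (2^-1 : R) ^+ (x p).2.
  rewrite inE => /andP[_ xJ].
  rewrite -expr_sum exprVn ler_pdivlMr ?exprn_gt0 // mul1r.
  rewrite ler_weXn2l ?ler1n //; apply: leq_trans xJ; apply: leq_sum => p _.
  by rewrite expnS expn1; case: (nat_of_ord _) => // k; rewrite leq_pmulr.
rewrite -sum1_card natr_sum.
apply: le_trans (_ : \sum_(x in family Q)
   (2 : R) ^+ (16 * #|J|) * \prod_p (2^-1 : R) ^+ (x p).2 <= _).
  rewrite big_mkcond [leRHS]big_mkcond; apply: ler_sum => x _.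
  case: ifP => [xL|_].
    suff -> : x \in family Q by apply: h1.
    by apply/familyP => p; move: xL; rewrite inE => /andP[/forallP /(_ p)].
  case: ifP => // _; rewrite mulr_ge0 ?exprn_ge0 // prodr_ge0 // => p _.
  by rewrite exprn_ge0 // invr_ge0.
rewrite -mulr_sumr -(bigA_distr_big_dep Q (fun p c => (2^-1 : R) ^+ c.2)) /=.
rewrite (_ : (18 * #|J|)%N = (16 * #|J| + 2 * #|J|)%N); last by lia.
rewrite exprD ler_wpM2l ?exprn_ge0 // exprM.
apply: le_trans (_ : \prod_p (if p \in J then 4 else 1) <= _); last first.
  by rewrite -big_mkcond prodr_const (_ : 2 ^+ 2 = 4) //; lra.
apply: ler_prod => p _; apply/andP; split.
  by apply: sumr_ge0 => c _; rewrite exprn_ge0 // invr_ge0.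
rewrite /Q; case: ifP => pJ /=; first exact: sum_lat_coord.
by rewrite big_pred1_eq /= expr0.
Qed.

Definition lattice_mx (w : 'I_n -> 'I_K -> R) (x : {ffun 'I_n * 'I_K -> lat_coord}) :
    'M[R]_(n, K) :=
  \matrix_(i, l) (lat_val (x (i, l)) / w i l).

Lemma lattice_round (w : 'I_n -> 'I_K -> R) (y : 'M[R]_(n, K)) :
  (forall i l, (i, l) \in J -> 0 < w i l) ->
  (forall i l, (i, l) \notin J -> y i l = 0) ->
  \sum_(p in J) (y p.1 p.2 * w p.1 p.2) ^+ 2 <= 16 * #|J|%:R ->
  exists2 x, x \in lattice_pts &
    forall i l, `|lattice_mx w x i l| <= `|y i l| /\
      `|y i l - lattice_mx w x i l| <= (if (i, l) \in J then (w i l)^-1 else 0).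
Proof.
move=> w0 yJ yw.
have JN : (#|J| <= n * K)%N.
  by apply: leq_trans (max_card _) _; rewrite card_prod !card_ord.
(* A coordinate is at most 4 sqrt |J| <= 4 |J| <= 4nK, hence within the range of [lat_coord]. *)
have ybd p : p \in J -> `|y p.1 p.2 * w p.1 p.2| <= (4 * (n * K))%:R.
  move=> pJ; have J0 : (0 < #|J|)%N by apply/card_gt0P; exists p.
  apply: le_trans (_ : (4 * #|J|)%:R <= _); last by rewrite ler_nat; lia.
  rewrite -ler_sqr ?nnegrE // real_normK ?num_real //.
  apply: le_trans (_ : 16 * #|J|%:R <= _); last first.
    by rewrite -natrX -natrM ler_nat; nia.
  apply: le_trans yw; rewrite (bigD1 p) //= lerDl.
  by apply: sumr_ge0 => *; rewrite sqr_ge0.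
have /fin_all_exists [f fP] (p : 'I_n * 'I_K) : exists c : lat_coord,
   if p \in J then `|lat_val c| <= `|y p.1 p.2 * w p.1 p.2| /\
                   `|y p.1 p.2 * w p.1 p.2 - lat_val c| <= 1
   else c = lat_coord0.
  case pJ: (p \in J); last by exists lat_coord0.
  exact: lat_coord_round (ybd p pJ).
exists [ffun p => f p].
  rewrite inE; apply/andP; split.
    by apply/forallP => p; rewrite ffunE; have := fP p; case: ifP => //= _ ->.
  rewrite -(ler_nat R) natr_sum natrM; apply: le_trans yw.
  rewrite [leRHS]big_mkcond; apply: ler_sum => p _; rewrite ffunE natrX.
  have := fP p; case: ifP => [_ [h _]|_ -> //]; last by rewrite expr0n.
  have -> : (f p).2%:R ^+ 2 = lat_val (f p) ^+ 2 :> R.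
    by rewrite /lat_val exprMn sqrr_sign mul1r.
  by rewrite -(real_normK (num_real (y _ _ * _))) -(real_normK (num_real (lat_val _))) ler_sqr ?nnegrE.
move=> i l; rewrite !mxE ffunE; have := fP (i, l) => /=.
case: ifP => [iJ [h1 h2]|iJ ->]; last first.
  by rewrite lat_val0 mul0r subr0 (yJ i l) ?iJ // normr0.
have wp := w0 _ _ iJ; split.
  rewrite normrM normfV (gtr0_norm wp) ler_pdivrMr //.
  by rewrite -[X in _ <= _ * X](gtr0_norm wp) -normrM.
rewrite -[X in _ <= X]mul1r ler_pdivlMr // -[X in _ * X <= _](gtr0_norm wp) -normrM.
by rewrite mulrBl divfK ?gt_eqF.
Qed.

(** Inverse mesh: |J| coordinate errors of at most 1/(4 sqrt |J|) add up to a Euclidean error of at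
    most 1/4. *)
Definition row_scale (i : 'I_n) (l : 'I_K) : R := 4 * Num.sqrt #|J|%:R.

Definition block_supp (l k : 'I_K) : {set 'I_n} := [set j | (z j == l) && ((j, k) \in J)].

(** The error must be at most 1/4 in every block separately, so the mesh adapts to the size of the
    block's support. *)
Definition block_scale (j : 'I_n) (k : 'I_K) : R :=
  4 * Num.sqrt #|block_supp (z j) k|%:R.

Lemma ball_round a : in_ball a -> (forall i l, (i, l) \notin J -> a i l = 0) ->
  exists2 x, x \in lattice_pts &
    in_ball (lattice_mx row_scale x) /\ in_ball (4 *: (a - lattice_mx row_scale x)).
Proof.
move=> a1 aJ.
have sq (y : R) : y ^+ 2 = `|y| ^+ 2 by rewrite real_normK // num_real.
have wp i l : (i, l) \in J -> 0 < row_scale i l.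
  move=> iJ; rewrite mulr_gt0 // sqrtr_gt0 ltr0n; apply/card_gt0P; by exists (i, l).
have w2 i l : row_scale i l ^+ 2 = 16 * #|J|%:R.
  rewrite exprMn sqr_sqrtr //; ring.
have [] := lattice_round wp aJ.
  under eq_bigr => p _ do rewrite exprMn w2.
  rewrite -mulr_suml mulrC ler_piMr // ?mulr_ge0 //.
  apply: le_trans a1; rewrite /frob2 pair_big /= big_mkcond /=.
  by apply: ler_sum => p _; case: ifP => // _; exact: sqr_ge0.
move=> x xL hx; exists x => //; split.
  apply: le_trans a1; apply: ler_sum => i _; apply: ler_sum => l _.
  by rewrite [leLHS]sq [leRHS]sq ler_sqr ?nnegrE //; case: (hx i l).
rewrite /in_ball /frob2 pair_big /=.
apply: le_trans (_ : \sum_(p in J) (#|J|%:R : R)^-1 <= _); last first.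
  rewrite sumr_const -[X in X <= _]mulr_natl.
  have [->|J0] := eqVneq #|J| 0%N; first by rewrite mul0r.
  by rewrite mulfV // pnatr_eq0.
rewrite [leRHS]big_mkcond; apply: ler_sum => -[i l] _; rewrite mxE exprMn.
have [_ /=] := hx i l; rewrite !mxE; case: ifP => [iJ h|iJ]; last first.
  by rewrite normr_le0 => /eqP ->; rewrite expr0n mulr0.
rewrite [X in _ * X]sq.
apply: le_trans (_ : 4 ^+ 2 * (row_scale i l)^-1 ^+ 2 <= _).
  rewrite ler_wpM2l ?sqr_ge0 // ler_sqr ?nnegrE // ltW // invr_gt0; exact: wp.
rewrite exprVn w2 invfM mulrA (_ : 4 ^+ 2 / 16 = 1) ?mul1r //.
lra.
Qed.

(** The adaptive mesh stays in the same lattice set: each block contributes at most 16 times its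
    support size to the rescaled squared norm, and these supports partition [J]. *)
Lemma block_round v : in_block_balls v -> (forall i l, (i, l) \notin J -> v i l = 0) ->
  exists2 x, x \in lattice_pts &
    in_block_balls (lattice_mx block_scale x) /\
    in_block_balls (4 *: (v - lattice_mx block_scale x)).
Proof.
move=> v1 vJ.
have sq (y : R) : y ^+ 2 = `|y| ^+ 2 by rewrite real_normK // num_real.
have wp i l : (i, l) \in J -> 0 < block_scale i l.
  move=> iJ; rewrite mulr_gt0 // sqrtr_gt0 ltr0n; apply/card_gt0P; exists i.
  by rewrite inE eqxx.
have w2 i l : block_scale i l ^+ 2 = 16 * #|block_supp (z i) l|%:R.
  rewrite exprMn sqr_sqrtr //; ring.
have cardJ : #|J|%:R = \sum_k \sum_l #|block_supp l k|%:R :> R.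
  rewrite -sum1_card natr_sum exchange_big /=.
  rewrite (eq_bigl (fun p => predT p.1 && (p \in J))) //.
  rewrite (eq_bigr (fun p : 'I_n * 'I_K => (fun _ _ => 1 : R) p.1 p.2)) //.
  rewrite (eq_bigl (fun p => predT p.1 && (fun i l => (i, l) \in J) p.1 p.2)); last by case.
  rewrite -(pair_big_dep predT (fun i l => (i, l) \in J) (fun _ _ => 1 : R)) /=.
  rewrite (partition_big z predT) //=; apply: eq_bigr => l _.
  rewrite (exchange_big_dep predT) //=; apply: eq_bigr => k _.
  by rewrite -sum1_card natr_sum; apply: eq_big => // j; rewrite inE.
have [] := lattice_round wp vJ.
  under eq_bigr => p _ do rewrite exprMn w2.
  rewrite cardJ mulr_sumr.
  apply: le_trans (_ : \sum_(p : 'I_n * 'I_K)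
     v p.1 p.2 ^+ 2 * (16 * #|block_supp (z p.1) p.2|%:R) <= _).
    rewrite big_mkcond; apply: ler_sum => p _; case: ifP => // _.
    by rewrite mulr_ge0 ?sqr_ge0 // mulr_ge0.
  rewrite -(pair_big predT predT
    (fun i l => v i l ^+ 2 * (16 * #|block_supp (z i) l|%:R))) /= exchange_big /=.
  apply: ler_sum => k _; rewrite mulr_sumr (partition_big z predT) //=.
  apply: ler_sum => l _.
  rewrite -[leRHS]mul1r; apply: le_trans (ler_wpM2r _ (v1 k l)); last by rewrite mulr_ge0.
  by rewrite mulr_suml; apply: ler_sum => j /eqP ->.
move=> x xL hx; exists x => //; split=> k l.
  apply: le_trans (v1 k l); apply: ler_sum => i _.
  by rewrite [leLHS]sq [leRHS]sq ler_sqr ?nnegrE //; case: (hx i k).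
apply: le_trans (_ : \sum_(j in block_supp l k) (#|block_supp l k|%:R : R)^-1 <= _); last first.
  rewrite sumr_const -[X in X <= _]mulr_natl.
  have [->|J0] := eqVneq #|block_supp l k| 0%N; first by rewrite mul0r.
  by rewrite mulfV // pnatr_eq0.
rewrite big_mkcond [leRHS]big_mkcond; apply: ler_sum => j _.
rewrite inE; case: eqP => [zj /=|//]; rewrite mxE exprMn.
have [_ /=] := hx j k; rewrite !mxE; case: ifP => [jJ h|jJ]; last first.
  by rewrite normr_le0 => /eqP ->; rewrite expr0n mulr0.
rewrite [X in _ * X]sq.
apply: le_trans (_ : 4 ^+ 2 * (block_scale j k)^-1 ^+ 2 <= _).
  rewrite ler_wpM2l ?sqr_ge0 // ler_sqr ?nnegrE // ltW // invr_gt0; exact: wp.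
rewrite exprVn w2 zj invfM mulrA (_ : 4 ^+ 2 / 16 = 1) ?mul1r //.
lra.
Qed.

(* The supremum [M] of the form over the balls satisfies [M <= r + M / 4 + M / 4]. *)
Lemma net_bound (X : 'M[R]_n) (r : R) :
  (forall i j, X i j != 0 -> ((i, z j) \in J) && ((j, z i) \in J)) ->
  (forall x y, x \in lattice_pts -> y \in lattice_pts ->
     let T := bilin (lattice_mx row_scale x) (lattice_mx block_scale y) in
     frob2 T <= 1 -> inner X T <= r) ->
  forall a v, in_ball a -> in_block_balls v -> inner X (bilin a v) <= 2 * r.
Proof.
move=> XJ net.
pose S := [set s : R | exists a v, [/\ in_ball a, in_block_balls v & s = inner X (bilin a v)]]%classic.
have S0 : (S !=set0)%classic.
  exists (inner X (bilin 0 0)), 0, 0; split => //.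
    by rewrite /in_ball /frob2 big1 // => i _; rewrite big1 // => j _; rewrite mxE expr0n.
  by move=> k l; rewrite big1 // => j _; rewrite mxE expr0n.
have Sub : has_ubound S.
  exists (\sum_i \sum_j `|X i j|) => _ [a [v [a1 v1 ->]]]; exact: inner_bilin_bound.
have inS a v : in_ball a -> in_block_balls v -> inner X (bilin a v) <= sup S.
  by move=> a1 v1; apply: ub_le_sup => //; exists a, v.
have step a v : in_ball a -> in_block_balls v -> inner X (bilin a v) <= r + sup S / 2.
  move=> a1 v1.
  have ra1 : in_ball (mx_restrict a).
    by apply: le_trans a1; apply: ler_sum => i _; apply: ler_sum => l _; exact: sqr_restrict.
  have rv1 : in_block_balls (mx_restrict v).
    by move=> k l; apply: le_trans (v1 k l); apply: ler_sum => j _; exact: sqr_restrict.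
  have rJ b i l : (i, l) \notin J -> mx_restrict b i l = 0 by rewrite mxE => /negbTE ->.
  have [x xL [x1 x2]] := ball_round ra1 (rJ a).
  have [y yL [y1 y2]] := block_round rv1 (rJ v).
  rewrite -(inner_bilin_restrict a v XJ).
  set ra := mx_restrict a in ra1 x2 *; set rv := mx_restrict v in rv1 y2 *.
  set xa := lattice_mx _ x in x1 x2; set yv := lattice_mx _ y in y1 y2.
  have h1 := inS _ _ x2 rv1; have h2 := inS _ _ x1 y2.
  have h3 := net _ _ xL yL (frob2_bilin x1 y1).
  rewrite inner_bilinZl in h1; rewrite inner_bilinZr in h2.
  rewrite -{1}(subrK xa ra) inner_bilinDl -{2}(subrK yv rv) inner_bilinDr.
  by rewrite -/xa -/yv in h3; lra.
have : sup S <= r + sup S / 2.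
  by apply: ge_sup => // _ [a [v [a1 v1 ->]]]; exact: step.
by move=> hs a v a1 v1; have := inS a v a1 v1; lra.
Qed.

Lemma sum_blocks (g : 'I_K -> 'I_K -> 'I_n -> 'I_n -> R) :
  \sum_k \sum_l \sum_i \sum_j (if (z i == k) && (z j == l) then g k l i j else 0) =
  \sum_i \sum_j g (z i) (z j) i j.
Proof.
under eq_bigr => k _ do rewrite exchange_big.
rewrite exchange_big; apply: eq_bigr => i _ /=.
rewrite (bigD1 (z i)) //= [X in _ + X]big1 ?addr0; last first.
  by move=> k /negbTE ki; rewrite big1 // => l _; rewrite big1 // => j _; rewrite eq_sym ki.
rewrite exchange_big; apply: eq_bigr => j _ /=.
rewrite (bigD1 (z j)) //= big1 ?addr0 ?eqxx //.
by move=> l /negbTE lj; rewrite (eq_sym (z j)) lj andbF.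
Qed.

Definition blk_form (X : 'M[R]_n) (u v : 'I_K -> 'I_K -> 'I_n -> R) (k l : 'I_K) : R :=
  \sum_i \sum_j blk z k l X i j * (u k l i * v k l j).

(* With [S] the sum of squares, test the form on [a = u * blk_form / sqrt S]. *)
Lemma sum_blk_form_le (X : 'M[R]_n) (r : R) (u v : 'I_K -> 'I_K -> 'I_n -> R) :
  (forall a b, in_ball a -> in_block_balls b -> inner X (bilin a b) <= r) ->
  (forall k l, \sum_i u k l i ^+ 2 <= 1) -> (forall k l, \sum_i v k l i ^+ 2 <= 1) ->
  \sum_k \sum_l blk_form X u v k l ^+ 2 <= r ^+ 2.
Proof.
move=> Xr u1 v1; set S := \sum_k _.
have S0 : 0 <= S by apply: sumr_ge0 => k _; apply: sumr_ge0 => l _; exact: sqr_ge0.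
have [->|Sn0] := eqVneq S 0; first exact: sqr_ge0.
have Sp : 0 < S by rewrite lt_def Sn0.
have sSp : 0 < Num.sqrt S by rewrite sqrtr_gt0.
pose a : 'M[R]_(n, K) := \matrix_(i, l) (blk_form X u v (z i) l / Num.sqrt S * u (z i) l i).
pose b : 'M[R]_(n, K) := \matrix_(j, k) (v k (z j) j).
have a1 : in_ball a.
  rewrite /in_ball /frob2 (partition_big z predT) //=.
  apply: le_trans (_ : \sum_k \sum_l blk_form X u v k l ^+ 2 / S <= _); last first.
    under eq_bigr => k _ do rewrite -mulr_suml.
    by rewrite -mulr_suml -/S mulfV.
  apply: ler_sum => k _; rewrite exchange_big; apply: ler_sum => l _ /=.
  have -> : \sum_(i | z i == k) a i l ^+ 2 =
      blk_form X u v k l ^+ 2 / S * \sum_(i | z i == k) u k l i ^+ 2.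
    rewrite mulr_sumr; apply: eq_bigr => i /eqP zi.
    by rewrite mxE zi !exprMn exprVn sqr_sqrtr.
  rewrite ler_piMr ?divr_ge0 ?sqr_ge0 //.
  apply: le_trans (u1 k l); rewrite big_mkcond; apply: ler_sum => i _.
  by case: ifP => // _; exact: sqr_ge0.
have b1 : in_block_balls b.
  move=> k l; apply: le_trans (v1 k l); rewrite big_mkcond; apply: ler_sum => j _.
  by case: eqP => [zj|_]; rewrite ?sqr_ge0 // mxE zj.
have := Xr a b a1 b1.
suff -> : inner X (bilin a b) = Num.sqrt S.
  move=> h; rewrite -[leLHS]sqr_sqrtr // ler_sqr ?nnegrE ?sqrtr_ge0 //.
  exact: le_trans (sqrtr_ge0 _) h.
apply: (@mulIf _ (Num.sqrt S)); first by rewrite gt_eqF.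
rewrite -[RHS]expr2 [RHS]sqr_sqrtr //.
pose g k l i j := blk_form X u v k l * (X i j * (u k l i * v k l j)).
rewrite [RHS](_ : S = \sum_i \sum_j g (z i) (z j) i j); last first.
  rewrite -sum_blocks /S; apply: eq_bigr => k _; apply: eq_bigr => l _.
  rewrite expr2 {2}/blk_form mulr_sumr; apply: eq_bigr => i _; rewrite mulr_sumr.
  apply: eq_bigr => j _; rewrite mxE /g; case: ifP => // _; by rewrite mul0r mulr0.
rewrite /inner mulr_suml; apply: eq_bigr => i _; rewrite mulr_suml.
apply: eq_bigr => j _; rewrite !mxE /g; field; by rewrite gt_eqF.
Qed.

End LatticeNet.

(** * The support of the mean matrix and the union bound *)

Section Supports.
Variables (R : realType) (n K : nat).

(** The family Jbreve as one set of pairs (i, l); its first index k is determined by i. *)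
Definition supp_pairs (P : 'M[R]_n) (z : labels n K) : {set 'I_n * 'I_K} :=
  [set p | [exists j, (z j == p.2) && (P p.1 j != 0)]].

Lemma cardJbreveE (P : 'M[R]_n) (z : labels n K) :
  cardJbreve P z = #|supp_pairs P z|%:R.
Proof.
have -> : #|supp_pairs P z|%:R =
    \sum_i \sum_l (if (i, l) \in supp_pairs P z then 1 else 0 : R).
  by rewrite pair_big /= -sum1_card natr_sum big_mkcond; apply: eq_bigr => -[].
rewrite /cardJbreve exchange_big /=.
rewrite [RHS]exchange_big; apply: eq_bigr => l _ /=.
rewrite [RHS](partition_big z predT) //=; apply: eq_bigr => k _.
rewrite -sum1_card natr_sum big_mkcond [RHS]big_mkcond; apply: eq_bigr => i _.
by rewrite !inE /=; case: (z i == k).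
Qed.

Lemma sum_csize (z : labels n K) : \sum_k csize R z k = n%:R.
Proof.
have -> : n%:R = \sum_(i < n) 1 :> R by rewrite sumr_const card_ord.
rewrite (partition_big z predT) //=; apply: eq_bigr => k _.
by rewrite /csize -sum1_card natr_sum; apply: eq_bigl => i; rewrite inE.
Qed.

(* Union bound over the labellings and, for each of them, over the lattice
   points; the exponent [36 (m + n ln K + t)] beats the [2 ^ (36 m)] pairs of
   lattice points and the [K ^ n] labellings. *)
Definition dev (P : 'M[R]_n) (t : R) (z : labels n K) : R :=
  24 * Num.sqrt (cardJbreve P z + n%:R * ln K%:R + t).

(** The exceptional event of one labelling. The bound [frob2 (T x) <= 1] is built in so that
    [noise_tail] has a fixed variance proxy. *)
Definition net_exceeds (P : 'M[R]_n) (t : R) (z : labels n K) : pred 'M[bool]_n :=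
  fun a =>
  let J := supp_pairs P z in
  let T x := bilin z (lattice_mx (@row_scale R n K J) x.1)
                     (lattice_mx (block_scale R z J) x.2) in
  [exists x, [&& x.1 \in lattice_pts J, x.2 \in lattice_pts J & frob2 (T x) <= 1]
             && (dev P t z <= inner (Amat R a - P) (T x))].

Lemma Prob_net_exceeds (P : 'M[R]_n) (t : R) :
  (0 < K)%N -> (forall i j, 0 <= P i j <= 1) -> (forall i j, P i j = P j i) -> 0 <= t ->
  Prob P (fun a => [exists z : labels n K, true && net_exceeds P t z a]) <= expR (- t).
Proof.
move=> K0 P01 Psym t0.
set G := n%:R * ln K%:R + t.
have G0 : 0 <= n%:R * ln K%:R :> R by rewrite mulr_ge0 // ln_ge0 // ler1n.
apply: le_trans (Prob_exists P01 _ _) _.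
(* There are K^n = exp(n ln K) labellings, which the term n ln K in [G] cancels. *)
apply: le_trans (_ : \sum_(z : labels n K) expR (- G) <= _); last first.
  rewrite sumr_const card_ffun !card_ord -[X in X <= _]mulr_natl natrX.
  rewrite -{1}(@lnK R K%:R) ?posrE ?ltr0n // -expRM_natl -expRD ler_expR /G; lra.
apply: ler_sum => z _.
set J := supp_pairs P z; set m : R := #|J|%:R.
have Jm : cardJbreve P z = m by exact: cardJbreveE.
have m0 : 0 <= m by [].
pose T (x : {ffun 'I_n * 'I_K -> lat_coord n K} * {ffun 'I_n * 'I_K -> lat_coord n K}) :=
  bilin z (lattice_mx (@row_scale R n K J) x.1) (lattice_mx (block_scale R z J) x.2).
pose D x := [&& x.1 \in lattice_pts J, x.2 \in lattice_pts J & frob2 (T x) <= 1].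
pose E x (a : 'M[bool]_n) := dev P t z <= inner (Amat R a - P) (T x).
change (Prob P (fun a => [exists x, D x && E x a]) <= expR (- G)).
apply: le_trans (Prob_exists P01 D E) _.
apply: le_trans (_ : \sum_(x in finset.setX (lattice_pts J) (lattice_pts J)) expR (- (36 * (m + G))) <= _).
  rewrite big_mkcond [leRHS]big_mkcond; apply: ler_sum => x _.
  rewrite finset.inE /=; rewrite /D; case: ifP => [/and3P[-> -> T1] /=|_]; last first.
    by case: ifP => // _; rewrite expR_ge0.
  have d0 : 0 <= dev P t z by rewrite mulr_ge0 // sqrtr_ge0.
  (* The choice [dev P t z / 8] minimises 4 lam^2 - lam dev; the minimum is -dev^2/16 = -36(m + G),
     as 24^2 = 576. *)
  apply: le_trans (noise_tail P01 Psym _ _ (divr_ge0 d0 (ler0n R 8))) _.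
  rewrite ler_expR.
  have d2 : dev P t z ^+ 2 = 576 * (m + G).
    rewrite exprMn sqr_sqrtr Jm; first by rewrite /G; ring.
    by rewrite /G in G0 *; lra.
  move: T1; set q := frob2 _ => q1.
  have : 4 * (dev P t z / 8) ^+ 2 * q <= 4 * (dev P t z / 8) ^+ 2.
    by rewrite ler_piMr // mulr_ge0 // sqr_ge0.
  by move: d2; rewrite !expr2; lra.
rewrite sumr_const cardsX -[X in X <= _]mulr_natl natrM.
have e2 : (2 : R) <= expR 1 by have := expR_ge1Dx (1 : R); lra.
have hL : #|lattice_pts J|%:R <= expR (18 * m) :> R.
  apply: le_trans (card_lattice_pts R J) _.
  rewrite -[in leRHS](mulr1 (18 * m)) /m -natrM expRM_natl.
  by rewrite lerXn2r ?nnegrE // expR_ge0.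
apply: le_trans (_ : expR (18 * m) * expR (18 * m) * expR (- (36 * (m + G))) <= _).
  rewrite ler_wpM2r ?expR_ge0 // ler_pM //.
by rewrite -!expRD ler_expR /G; rewrite /G in G0 *; lra.
Qed.

(** Passing from the net to the full balls doubles [dev], and (2 * 24)^2 = 2304. The net on
    [supp_pairs P z] suffices because the noise vanishes where [P] does. *)
Lemma sum_blk_form_noise (P : 'M[R]_n) (t : R) (z : labels n K) (a : 'M[bool]_n)
    (u v : 'I_K -> 'I_K -> 'I_n -> R) :
  (0 < K)%N -> 0 <= t -> (forall i j, P i j = P j i) ->
  (forall i j, a i j -> P i j != 0) -> ~~ net_exceeds P t z a ->
  (forall k l, \sum_i u k l i ^+ 2 <= 1) -> (forall k l, \sum_i v k l i ^+ 2 <= 1) ->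
  \sum_k \sum_l blk_form z (Amat R a - P) u v k l ^+ 2 <=
    2304 * (cardJbreve P z + n%:R * ln K%:R + t).
Proof.
move=> K0 t0 Psym aP nex u1 v1.
have G0 : 0 <= n%:R * ln K%:R :> R by rewrite mulr_ge0 // ln_ge0 // ler1n.
have -> : 2304 * (cardJbreve P z + n%:R * ln K%:R + t) = (2 * dev P t z) ^+ 2.
  rewrite /dev !exprMn sqr_sqrtr; first by ring.
  by rewrite cardJbreveE addr_ge0 // addr_ge0.
apply: sum_blk_form_le => //; apply: (@net_bound _ _ _ _ (supp_pairs P z)).
  move=> i j; rewrite !mxE => X0; have Pij : P i j != 0.
    by apply: contraNneq X0 => Pij; have := aP i j; rewrite Pij eqxx; case: (a i j) => // [/(_ isT)|_] //; rewrite subr0.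
  rewrite !inE /=; apply/andP; split; apply/existsP; [exists j|exists i].
    by rewrite eqxx.
  by rewrite eqxx -Psym.
move=> x y xL yL T T1; rewrite leNgt; apply: contraNN nex => /ltW hd.
by apply/existsP; exists (x, y); rewrite /= xL yL T1.
Qed.

End Supports.

(** * Operator norms and residuals of rank-one approximations *)

Section MatrixNorms.
Variables (R : realType) (n : nat).

Lemma cauchy_schwarz_unit (u w : 'I_n -> R) : \sum_i u i ^+ 2 <= 1 ->
  \sum_i u i * w i <= Num.sqrt (\sum_i w i ^+ 2).
Proof.
move=> u1; set q := Num.sqrt _; set W := \sum_i w i ^+ 2 in q *.
have W0 : 0 <= W by apply: sumr_ge0 => i _; exact: sqr_ge0.
have q2 : q ^+ 2 = W by exact: sqr_sqrtr.
have [q0|qn0] := eqVneq q 0.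
  have /eqP : W = 0 by rewrite -q2 q0 expr0n.
  rewrite psumr_eq0 => [/allP w0|i _]; last exact: sqr_ge0.
  rewrite q0 big1 // => i _; have := w0 i (mem_index_enum i).
  by rewrite /= sqrf_eq0 => /eqP ->; rewrite mulr0.
have qp : 0 < q by rewrite lt_def qn0 sqrtr_ge0.
(* Weighted arithmetic-geometric mean inequality, with the weight [q] that makes both halves at most
   q/2. *)
apply: le_trans (_ : \sum_i (q / 2 * u i ^+ 2 + (2 * q)^-1 * w i ^+ 2) <= _).
  apply: ler_sum => i _; rewrite -(ler_pM2l (_ : 0 < 2 * q)); last lra.
  have -> : 2 * q * (q / 2 * u i ^+ 2 + (2 * q)^-1 * w i ^+ 2) =
            (q * u i) ^+ 2 + w i ^+ 2 by field.
  by have := sqr_ge0 (q * u i - w i); nra.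
rewrite big_split /= -!mulr_sumr -/W -q2.
have -> : (2 * q)^-1 * q ^+ 2 = q / 2 by field.
by nra.
Qed.

Lemma bilinear_le_opnorm (X : 'M[R]_n) (u v : 'I_n -> R) :
  \sum_i u i ^+ 2 <= 1 -> \sum_i v i ^+ 2 <= 1 ->
  \sum_i \sum_j X i j * (u i * v j) <= opnorm X.
Proof.
move=> u1 v1; pose vv : 'cV[R]_n := \col_j v j.
have -> : \sum_i \sum_j X i j * (u i * v j) = \sum_i u i * (X *m vv) i 0.
  apply: eq_bigr => i _; rewrite mxE mulr_sumr; apply: eq_bigr => j _.
  by rewrite mxE; ring.
apply: le_trans (cauchy_schwarz_unit _ u1) _.
apply: ub_le_sup; last first.
  exists vv => //=; rewrite /vnorm -(sqrtr1 R) ler_sqrt //.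
  by under eq_bigr => j _ do rewrite mxE.
(* The set defining [opnorm] must be bounded for [sup] to be an upper bound; row sums give a crude
   bound. *)
exists (Num.sqrt (\sum_i (\sum_j `|X i j|) ^+ 2)) => _ [w /= w1 <-].
apply: ler_wsqrtr; apply: ler_sum => i _.
rewrite -[leLHS]real_normK ?num_real // ler_sqr ?nnegrE ?sumr_ge0 //.
rewrite mxE; apply: le_trans (ler_norm_sum _ _ _) _; apply: ler_sum => j _.
rewrite normrM ler_piMr //.
have w2 : \sum_i w i 0 ^+ 2 <= 1.
  rewrite -(@ler_sqrt _ _ 1) // sqrtr1; exact: w1.
rewrite -[leRHS]normr1 -ler_sqr ?nnegrE // !real_normK ?num_real // expr1n.
apply: le_trans w2; rewrite (bigD1 j) //= lerDl.
by apply: sumr_ge0 => *; exact: sqr_ge0.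
Qed.

Lemma sqr_bilinear_le_opnorm (X : 'M[R]_n) (u v : 'I_n -> R) :
  \sum_i u i ^+ 2 <= 1 -> \sum_i v i ^+ 2 <= 1 ->
  (\sum_i \sum_j X i j * (u i * v j)) ^+ 2 <= opnorm X ^+ 2.
Proof.
move=> u1 v1; have h1 := bilinear_le_opnorm X u1 v1.
have uN : \sum_i (- u i) ^+ 2 <= 1 by under eq_bigr => i _ do rewrite sqrrN.
have := bilinear_le_opnorm X uN v1.
have -> : \sum_i \sum_j X i j * (- u i * v j) = - \sum_i \sum_j X i j * (u i * v j).
  rewrite -sumrN; apply: eq_bigr => i _; rewrite -sumrN; apply: eq_bigr => j _; ring.
by nra.
Qed.

Lemma rank1_factor (Y : 'M[R]_n) : (\rank Y <= 1)%N ->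
  exists u v : 'I_n -> R, forall i j, Y i j = u i * v j.
Proof.
move: (col_base Y) (row_base Y) (mulmx_base Y).
case: (\rank Y) => [|[|//]] c d <- _.
  by exists (fun _ => 0), (fun _ => 0) => i j; rewrite mxE big_ord0 mul0r.
by exists (fun i => c i 0), (fun j => d 0 j) => i j; rewrite mxE big_ord1.
Qed.

(** Write Y = u v^T, s = |u||v| and c = u^T X v. Then |X - Y|^2 = |X|^2 - 2c + s^2 is at least |X|^2
    - (c/s)^2, by completing the square. *)
Lemma rank1_residual (X Y : 'M[R]_n) : (\rank Y <= 1)%N ->
  exists u v : 'I_n -> R, [/\ \sum_i u i ^+ 2 <= 1, \sum_i v i ^+ 2 <= 1 &
    frob2 X - (\sum_i \sum_j X i j * (u i * v j)) ^+ 2 <= frob2 (X - Y)].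
Proof.
move=> /rank1_factor [u [v Yuv]].
set U := \sum_i u i ^+ 2; set V := \sum_i v i ^+ 2.
have U0 : 0 <= U by apply: sumr_ge0 => i _; exact: sqr_ge0.
have V0 : 0 <= V by apply: sumr_ge0 => i _; exact: sqr_ge0.
(* Division by zero gives zero, so a zero vector normalises to itself; hence [<= 1] and not
   equality. *)
have normalized (w : 'I_n -> R) :
    \sum_i (w i / Num.sqrt (\sum_j w j ^+ 2)) ^+ 2 <= 1.
  set W := \sum_j w j ^+ 2.
  have W0 : 0 <= W by apply: sumr_ge0 => i _; exact: sqr_ge0.
  under eq_bigr => i _ do rewrite exprMn exprVn sqr_sqrtr //.
  rewrite -mulr_suml -/W; have [->|Wn0] := eqVneq W 0; first by rewrite mul0r.
  by rewrite mulfV.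
exists (fun i => u i / Num.sqrt U), (fun j => v j / Num.sqrt V).
split; [exact: normalized|exact: normalized|].
have zero (w : 'I_n -> R) : \sum_j w j ^+ 2 = 0 -> forall i, w i = 0.
  move=> /eqP; rewrite psumr_eq0 => [/allP w0 i|j _]; last exact: sqr_ge0.
  by apply/eqP; rewrite -sqrf_eq0; apply: w0; rewrite mem_index_enum.
have expand : frob2 (X - Y) = frob2 X - 2 * (\sum_i \sum_j X i j * (u i * v j)) + U * V.
  rewrite /frob2 mulr_sumr /U mulr_suml -sumrB -big_split /=.
  apply: eq_bigr => i _; rewrite !mulr_sumr -sumrB -big_split /=.
  by apply: eq_bigr => j _; rewrite !mxE Yuv; ring.
set c := \sum_i \sum_j X i j * (u i * v j) in expand *.
have -> : \sum_i \sum_j X i j * (u i / Num.sqrt U * (v j / Num.sqrt V)) =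
          c / (Num.sqrt U * Num.sqrt V).
  rewrite /c mulr_suml; apply: eq_bigr => i _; rewrite mulr_suml.
  by apply: eq_bigr => j _; rewrite invfM; ring.
rewrite expand; set s := Num.sqrt U * Num.sqrt V.
have -> : U * V = s ^+ 2 by rewrite exprMn !sqr_sqrtr.
have [s0|sn0] := eqVneq s 0; last first.
  have cE : c = (c / s) * s by rewrite divfK.
  move: cE; set d := c / s => ->; have := sqr_ge0 (d - s); nra.
suff -> : c = 0 by rewrite s0 mul0r expr0n mulr0 subr0 addr0 lexx.
rewrite /c big1 // => i _; rewrite big1 // => j _.
have /orP[/eqP UV|/eqP UV] : (U == 0) || (V == 0).
- have /eqP := s0; rewrite mulf_eq0 !sqrtr_eq0 => /orP[h|h]; apply/orP; [left|right];
  by rewrite eq_le h.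
- by rewrite (zero u UV) mul0r mulr0.
- by rewrite (zero v UV) !mulr0.
Qed.

End MatrixNorms.

(** * Comparison of the penalties *)

Section Penalty.
Variable R : realType.

Lemma ln_le_subr1 (x : R) : 0 < x -> ln x <= x - 1.
Proof. by move=> x0; have := expR_ge1Dx (ln x); rewrite lnK //; lra. Qed.

Lemma xlog_ge_id (a c : R) : 0 <= a -> a * expR 1 <= c -> a <= xlog a c.
Proof.
move=> a0 ac; rewrite /xlog; case: eqVneq => [->//|an0].
have ap : 0 < a by rewrite lt_def an0.
rewrite -[leLHS]mulr1 ler_pM2l // -[leLHS](@expRK R) ler_ln ?posrE ?expR_gt0 //.
  by rewrite ler_pdivlMr // mulrC.
rewrite divr_gt0 //; apply: lt_le_trans ac; by rewrite mulr_gt0 // expR_gt0.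
Qed.

(** With y = c/x >= 1, ln c = ln y + ln x <= x ln y + x. This charges the terms ln n_k of [pen_s] to
    the sparsity terms. *)
Lemma ln_le_xlog (x c : R) : 1 <= x -> x <= c -> ln c <= xlog x (c * expR 1).
Proof.
move=> x1 xc; rewrite /xlog; case: eqVneq => [x0|xn0]; first by lra.
have xp : 0 < x by lra.
have cx : 1 <= c / x by rewrite ler_pdivlMr // mul1r.
have cE : c = (c / x) * x by rewrite divfK.
have -> : c * expR 1 / x = c / x * expR 1 by field.
rewrite cE mulfK //; move: (c / x) cx => {cE} y cx.
have yp : 0 < y by lra.
rewrite !lnM ?posrE ?expR_gt0 //.
rewrite expRK.
by have := ln_ge0 cx; have := ln_le_subr1 xp; nra.
Qed.

Lemma log_sum_inequality (I : finType) (x c : I -> R) :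
  (forall i, 0 <= x i) -> (forall i, x i <= c i) ->
  \sum_i xlog (x i) (c i) <= xlog (\sum_i x i) (\sum_i c i).
Proof.
move=> x0 xc; set X := \sum_i x i; set C := \sum_i c i.
have X0 : 0 <= X by exact: sumr_ge0.
have XC : X <= C by apply: ler_sum.
rewrite {2}/xlog; case: eqVneq => [/eqP|Xn0].
  rewrite psumr_eq0 // => /allP h; rewrite big1 // => i _.
  by rewrite /xlog (eqP (h i (mem_index_enum i))) eqxx.
have Xp : 0 < X by rewrite lt_def Xn0.
have Cp : 0 < C by apply: lt_le_trans Xp _.
(* Bound the logarithm of each ratio relative to C/X by its tangent at 1; the corrections sum to
   zero. *)
apply: le_trans (_ : \sum_i (x i * ln (C / X) + (c i * (X / C) - x i)) <= _).
  apply: ler_sum => i _; rewrite /xlog; case: eqVneq => [->|xn0].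
    by rewrite mul0r add0r subr0 mulr_ge0 ?divr_ge0 ?(ltW Cp) // (le_trans (x0 i)).
  have xp : 0 < x i by rewrite lt_def xn0 x0.
  have cp : 0 < c i by apply: lt_le_trans xp _.
  have -> : c i / x i = (C / X) * (c i * (X / C) / x i).
    by field; rewrite xn0 Xn0 gt_eqF.
  have yp : 0 < c i * (X / C) / x i by rewrite !(divr_gt0, mulr_gt0).
  rewrite [ln (C / X * _)]lnM ?posrE ?divr_gt0 ?mulr_gt0 ?invr_gt0 // mulrDr lerD2l.
  apply: le_trans (ler_wpM2l (ltW xp) (ln_le_subr1 yp)) _.
  by rewrite mulrBr mulr1 mulrC divfK.
rewrite big_split /= sumrB -!mulr_suml -/X -/C.
have -> : C * (X / C) = X by field; rewrite gt_eqF.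
by rewrite subrr addr0.
Qed.

Variables (n K : nat).

Lemma card_fam_bound (z : labels n K) (J : 'I_K -> 'I_K -> {set 'I_n}) (k l : 'I_K) :
  sfamily z J -> (#|J k l|)%:R <= csize R z k.
Proof. by move=> /(_ k l) zJ; rewrite /csize ler_nat; apply: subset_leq_card. Qed.

(** The terms in n and K alone cancel and the rest of the subtracted penalty is nonnegative. As
    every [Js k l] is nonempty, the K copies of ln n_k are paid for by the K sets [Js k l], which
    yields the factor [b1 + b2]. *)
Lemma pen_diff (sparse : bool) (b1 b2 : R) (zs z : labels n K)
    (Js J : 'I_K -> 'I_K -> {set 'I_n}) :
  0 < b1 -> 0 < b2 -> sfamily zs Js -> sfamily z J ->
  (forall k l, (0 < #|Js k l|)%N) ->
  pen sparse b1 b2 zs Js - pen sparse b1 b2 z J <=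
    (b1 + b2) * xlog (card_fam R Js) (n%:R * K%:R * expR 1).
Proof.
move=> b10 b20 zsJ zJ Js0.
have e1 : 1 <= expR 1 :> R by rewrite -[leLHS](expR0 R) ler_expR.
have sumcE (w : labels n K) : \sum_(k < K) \sum_(l < K) csize R w k * expR 1 =
    n%:R * K%:R * expR 1.
  under eq_bigr => k _ do rewrite sumr_const card_ord -[_ *+ _]mulr_natr.
  by rewrite -mulr_suml -mulr_suml sum_csize mulrAC.
have xlog0 (k l : 'I_K) : 0 <= xlog (#|J k l|)%:R (csize R z k * expR 1).
  apply: le_trans (xlog_ge_id _ _) => //.
  by rewrite ler_wpM2r ?expR_ge0 ?card_fam_bound.
have lsum : \sum_(k < K) \sum_(l < K) xlog (#|Js k l|)%:R (csize R zs k * expR 1) <=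
    xlog (card_fam R Js) (n%:R * K%:R * expR 1).
  rewrite -(sumcE zs) /card_fam !pair_big /=; apply: log_sum_inequality => // -[k l] /=.
  apply: le_trans (card_fam_bound k l zsJ) _.
  by rewrite ler_peMr.
have X0 : 0 <= xlog (card_fam R J) (n%:R * K%:R * expR 1).
  have c0 : 0 <= card_fam R J by apply: sumr_ge0 => k _; exact: sumr_ge0.
  apply: le_trans (xlog_ge_id c0 _) => //.
  rewrite -(sumcE z) /card_fam mulr_suml; apply: ler_sum => k _.
  rewrite mulr_suml; apply: ler_sum => l _.
  by rewrite ler_wpM2r ?expR_ge0 ?card_fam_bound.
have lnsum : K%:R * \sum_(k < K) ln (csize R zs k) <=
    \sum_(k < K) \sum_(l < K) xlog (#|Js k l|)%:R (csize R zs k * expR 1).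
  rewrite mulr_sumr; apply: ler_sum => k _.
  rewrite mulr_natl -[X in _ *+ X](card_ord K) -sumr_const; apply: ler_sum => l _.
  by apply: ln_le_xlog; [rewrite ler1n|exact: card_fam_bound].
have lnz0 : 0 <= K%:R * \sum_(k < K) ln (csize R z k).
  rewrite mulr_ge0 // sumr_ge0 // => k _; rewrite /csize.
  (* An empty community contributes [ln 0 = 0]. *)
  case: #|_| => [|c]; first by rewrite ln0.
  by rewrite ln_ge0 // ler1n.
have XJs0 : 0 <= \sum_(k < K) \sum_(l < K) xlog (#|J k l|)%:R (csize R z k * expR 1).
  by apply: sumr_ge0 => k _; exact: sumr_ge0.
have Js00 : 0 <= \sum_(k < K) \sum_(l < K) xlog (#|Js k l|)%:R (csize R zs k * expR 1).
  apply: sumr_ge0 => k _; apply: sumr_ge0 => l _; apply: le_trans (xlog_ge_id _ _) => //.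
  by rewrite ler_wpM2r ?expR_ge0 ?card_fam_bound.
have h1 := ler_wpM2l (ltW b10) lsum.
have h2 := ler_wpM2l (ltW b20) (le_trans lnsum lsum).
have h3 := mulr_ge0 (ltW b10) XJs0.
have h4 := mulr_ge0 (ltW b20) lnz0.
have h5 := mulr_ge0 (ltW b10) X0.
have h6 := mulr_ge0 (ltW b20) (le_trans Js00 lsum).
by rewrite /pen; case: sparse; rewrite /pen_s /pen_ns mulrDl; lra.
Qed.

End Penalty.

(** * Lower and upper bounds on the fit, and the split into signal and noise *)

Section Objective.
Variables (R : realType) (n K : nat).

Lemma sum_frob2_blk (z : labels n K) (X : 'M[R]_n) :
  \sum_k \sum_l frob2 (blk z k l X) = frob2 X.
Proof.
apply: etrans (sum_blocks z (fun _ _ i j => X i j ^+ 2)).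
apply: eq_bigr => k _; apply: eq_bigr => l _; apply: eq_bigr => i _.
by apply: eq_bigr => j _; rewrite mxE; case: ifP => // _; rewrite expr0n.
Qed.

Lemma fit_lower (pi1 : 'M[R]_n -> 'M[R]_n) (z : labels n K)
    (J : 'I_K -> 'I_K -> {set 'I_n}) (X : 'M[R]_n) :
  best_rank1 pi1 ->
  exists u v : 'I_K -> 'I_K -> 'I_n -> R,
    [/\ forall k l, \sum_i u k l i ^+ 2 <= 1, forall k l, \sum_i v k l i ^+ 2 <= 1 &
     frob2 X - \sum_k \sum_l blk_form z X u v k l ^+ 2 <=
     \sum_k \sum_l frob2 (blk z k l X - pi1 (projJ J k l (blk z k l X)))].
Proof.
move=> hpi.
have /choice [w wP] (p : 'I_K * 'I_K) : exists uv : ('I_n -> R) * ('I_n -> R),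
    [/\ \sum_i uv.1 i ^+ 2 <= 1, \sum_i uv.2 i ^+ 2 <= 1 &
    frob2 (blk z p.1 p.2 X) -
     (\sum_i \sum_j blk z p.1 p.2 X i j * (uv.1 i * uv.2 j)) ^+ 2 <=
    frob2 (blk z p.1 p.2 X - pi1 (projJ J p.1 p.2 (blk z p.1 p.2 X)))].
  have [r1 _] := hpi (projJ J p.1 p.2 (blk z p.1 p.2 X)).
  by have [u [v uvP]] := rank1_residual (blk z p.1 p.2 X) r1; exists (u, v).
exists (fun k l => (w (k, l)).1), (fun k l => (w (k, l)).2); split.
- by move=> k l; have [] := wP (k, l).
- by move=> k l; have [] := wP (k, l).
rewrite -(sum_frob2_blk z) -sumrB; apply: ler_sum => k _; rewrite -sumrB.
by apply: ler_sum => l _; have [] := wP (k, l).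
Qed.

Lemma rank_blk_outer (z : labels n K) (Lam : 'M[R]_(n, K)) (P : 'M[R]_n) (k l : 'I_K) :
  (forall i j, P i j = Lam i (z j) * Lam j (z i)) -> (\rank (blk z k l P) <= 1)%N.
Proof.
move=> PL.
have -> : blk z k l P =
  (\col_i (if z i == k then Lam i l else 0)) *m
  (\row_j (if z j == l then Lam j k else 0)).
  apply/matrixP => i j; rewrite !mxE big_ord1 !mxE.
  by case: eqP => [zi|_] /=; case: eqP => [zj|_]; rewrite ?mul0r ?mulr0 // PL zi zj.
exact: mulmx_max_rank.
Qed.

(** Since [X] vanishes outside [J], the projection fixes its blocks, and the blocks of [P] compete
    as rank-one approximations. *)
Lemma fit_upper (pi1 : 'M[R]_n -> 'M[R]_n) (z : labels n K)
    (J : 'I_K -> 'I_K -> {set 'I_n}) (X P : 'M[R]_n) :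
  best_rank1 pi1 -> (forall k l, (\rank (blk z k l P) <= 1)%N) ->
  (forall i j, X i j != 0 -> (i \in J (z i) (z j)) && (j \in J (z j) (z i))) ->
  \sum_k \sum_l frob2 (blk z k l X - pi1 (projJ J k l (blk z k l X))) <= frob2 (X - P).
Proof.
move=> hpi rP XJ; rewrite -(sum_frob2_blk z).
apply: ler_sum => k _; apply: ler_sum => l _.
have -> : projJ J k l (blk z k l X) = blk z k l X.
  apply/matrixP => i j; rewrite !mxE; case: ifP => // hJ; case: ifP => // /andP[/eqP zi /eqP zj].
  by apply/esym/eqP; apply: contraFT hJ => /XJ; rewrite zi zj.
apply: le_trans (_ : frob2 (blk z k l X - blk z k l P) <= _).
  by have [_] := hpi (blk z k l X); apply; exact: rP.
rewrite le_eqVlt; apply/orP; left; apply/eqP; congr frob2.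
by apply/matrixP => i j; rewrite !mxE; case: ifP => // _; rewrite subr0.
Qed.

Lemma blk_formD (z : labels n K) (X Y : 'M[R]_n) (u v : 'I_K -> 'I_K -> 'I_n -> R) k l :
  blk_form z (X + Y) u v k l = blk_form z X u v k l + blk_form z Y u v k l.
Proof.
rewrite /blk_form -big_split; apply: eq_bigr => i _; rewrite -big_split.
apply: eq_bigr => j _; rewrite !mxE /=; case: ifP => _; last by rewrite !mul0r addr0.
by rewrite mulrDl.
Qed.

(** Young's inequality 2xy <= (alpha/2) x^2 + (2/alpha) y^2, followed by 1 + 2/alpha <= 3/alpha. *)
Lemma sqrrD_le (x y alpha : R) : 0 < alpha -> alpha < 1 ->
  (x + y) ^+ 2 <= (1 + alpha / 2) * x ^+ 2 + 3 / alpha * y ^+ 2.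
Proof.
move=> a0 a1; rewrite -(ler_pM2l (_ : 0 < 2 * alpha)); last lra.
have -> : 2 * alpha * ((1 + alpha / 2) * x ^+ 2 + 3 / alpha * y ^+ 2) =
  (2 * alpha + alpha ^+ 2) * x ^+ 2 + 6 * y ^+ 2 by field; rewrite gt_eqF.
have := sqr_ge0 (alpha * x - 2 * y); have := sqr_ge0 y; nra.
Qed.

Lemma frob2B (X P : 'M[R]_n) :
  frob2 (X - P) = frob2 X - 2 * inner (X - P) P - frob2 P.
Proof.
rewrite /frob2 /inner mulr_sumr -!sumrB; apply: eq_bigr => i _.
rewrite mulr_sumr -!sumrB; apply: eq_bigr => j _; rewrite !mxE; ring.
Qed.

Lemma sum_sqr_blk_form_le (z : labels n K) (X P : 'M[R]_n) (alpha : R)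
    (u v : 'I_K -> 'I_K -> 'I_n -> R) :
  0 < alpha -> alpha < 1 ->
  (forall k l, \sum_i u k l i ^+ 2 <= 1) -> (forall k l, \sum_i v k l i ^+ 2 <= 1) ->
  \sum_k \sum_l blk_form z X u v k l ^+ 2 <=
  (1 + alpha / 2) * (\sum_k \sum_l opnorm (blk z k l P) ^+ 2) +
  3 / alpha * (\sum_k \sum_l blk_form z (X - P) u v k l ^+ 2).
Proof.
move=> a0 a1 u1 v1; rewrite !mulr_sumr -big_split; apply: ler_sum => k _ /=.
rewrite !mulr_sumr -big_split; apply: ler_sum => l _ /=.
have -> : blk_form z X u v k l = blk_form z P u v k l + blk_form z (X - P) u v k l.
  by rewrite -blk_formD addrC subrK.
apply: le_trans (sqrrD_le _ _ a0 a1) _; rewrite lerD2r ler_wpM2l //; first by lra.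
exact: sqr_bilinear_le_opnorm.
Qed.

End Objective.

(** * Assembling the deterministic and probabilistic estimates *)

Lemma absorb_constants (R : realType) (alpha F Q m X Js G t b Xs : R) :
  0 < alpha -> alpha < 1 / 2 -> 0 < t -> 0 <= G -> 0 <= Js -> 0 <= m -> 0 <= Q ->
  0 <= Xs -> 0 <= b -> m <= X ->
  (1 - alpha / 4) * F <=
    (1 + alpha / 2) * Q + 3 / alpha * (2304 * (m + G + t)) + 64 / alpha * t + b * Xs ->
  F < (1 + alpha) * Q + 8000 / alpha * X + 8000 / alpha * (Js + G + t) + 2 * b * Xs.
Proof.
move=> a0 a1 t0 G0 Js0 m0 Q0 Xs0 b0 mX.
set W := 8000 / alpha * X + 8000 / alpha * (Js + G + t).
(* Every term on the right is compared with [1 - alpha / 4] times its target; this factor exceeds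
   7/8 because [alpha < 1 / 2]. *)
have c0 : 0 < 1 - alpha / 4 by clear -a1; lra.
have hQ : (1 + alpha / 2) * Q <= (1 - alpha / 4) * ((1 + alpha) * Q).
  rewrite mulrA ler_wpM2r //; clear -a0 a1; nra.
have hb : b * Xs <= (1 - alpha / 4) * (2 * b * Xs).
  have : 0 <= b * Xs by exact: mulr_ge0.
  rewrite -mulrA; move: (b * Xs) => y y0; clear -a1 y0; nra.
have W0 : 0 <= W.
  rewrite /W -mulrDr mulr_ge0 ?divr_ge0 ?(ltW a0) //.
  by rewrite !addr_ge0 ?(le_trans m0 mX) ?(ltW t0).
have hW : 7 / 8 * W <= (1 - alpha / 4) * W by rewrite ler_wpM2r //; clear -a1; lra.
(* The choice 8000 makes 7/8 * 8000 = 7000 exceed 3 * 2304 + 64 = 6976; strictness comes from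
   [0 < t]. *)
have hlt : 3 / alpha * (2304 * (m + G + t)) + 64 / alpha * t < 7 / 8 * W.
  rewrite -(ltr_pM2l a0) /W.
  have -> : alpha * (3 / alpha * (2304 * (m + G + t)) + 64 / alpha * t) =
    6912 * (m + G + t) + 64 * t by field; rewrite gt_eqF.
  have -> : alpha * (7 / 8 * (8000 / alpha * X + 8000 / alpha * (Js + G + t))) =
    7000 * (X + Js + G + t) by field; rewrite gt_eqF.
  lra.
have -> : (1 + alpha) * Q + 8000 / alpha * X + 8000 / alpha * (Js + G + t) + 2 * b * Xs =
    (1 + alpha) * Q + 2 * b * Xs + W by rewrite /W; ring.
move=> key; rewrite -(ltr_pM2l c0); apply: le_lt_trans key _.
rewrite -(addrA _ (3 / alpha * _)) addrAC 2![(1 - _) * (_ + _)]mulrDr.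
by apply: ler_ltD; [exact: lerD|exact: lt_le_trans hW].
Qed.

(** The deterministic core: when both noise bounds hold, a solution strictly violates the separation
    condition, so it cannot lie in Upsilon. *)
Lemma frob2_lt_of_solution (R : realType) (n K : nat) (zs z : labels n K)
    (Lam : 'M[R]_(n, K)) (P A : 'M[R]_n) (pi1 : 'M[R]_n -> 'M[R]_n)
    (sparse : bool) (b1 b2 alpha t : R) :
  0 < b1 -> 0 < b2 ->
  (forall i j, P i j = Lam i (zs j) * Lam j (zs i)) -> A1 zs Lam -> best_rank1 pi1 ->
  is_solution pi1 sparse b1 b2 A z ->
  0 < alpha -> alpha < 1 / 2 -> 0 < t -> (0 < K)%N ->
  (forall i j, A i j != 0 -> P i j != 0) ->
  (forall u v : 'I_K -> 'I_K -> 'I_n -> R,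
    (forall k l, \sum_i u k l i ^+ 2 <= 1) -> (forall k l, \sum_i v k l i ^+ 2 <= 1) ->
    \sum_k \sum_l blk_form z (A - P) u v k l ^+ 2 <=
      2304 * (cardJbreve P z + n%:R * ln K%:R + t)) ->
  - (alpha / 4 * frob2 P + 64 / alpha * t) <= 2 * inner (A - P) P ->
  frob2 P < (1 + alpha) * (\sum_(k < K) \sum_(l < K) opnorm (blk z k l P) ^+ 2)
       + 8000 / alpha * xlog (cardJbreve P z) (n%:R * K%:R * expR 1)
       + 8000 / alpha * (cardJstar zs Lam + n%:R * ln K%:R + t)
       + 2 * (b1 + b2) * xlog (cardJstar zs Lam) (n%:R * K%:R * expR 1).
Proof.
move=> b10 b20 PL hA1 hpi [J [zJ opt]] a0 a1 t0 K0 AP noise dev0.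
pose Js (k l : 'I_K) : {set 'I_n} := [set i | (zs i == k) && (Lam i l != 0)].
have zsJ : sfamily zs Js.
  by move=> k l; apply/fintype.subsetP => i; rewrite !inE => /andP[].
(* If the vector Lambda^(k,l) were zero, the indicator of [l] would be a nontrivial linear relation,
   against A1. *)
have Js0 k l : (0 < #|Js k l|)%N.
  rewrite lt0n; apply/negP => /eqP Jkl.
  have h0 i : zs i == k -> \sum_(m < K) (m == l)%:R * Lam i m = 0.
    move=> zi; rewrite (bigD1 l) //= eqxx mul1r big1 => [|m /negbTE ->]; last by rewrite mul0r.
    rewrite addr0; apply/eqP/negPn/negP => Li.
    by have := cards0_eq Jkl => /setP /(_ i); rewrite !inE zi Li.
  by have /eqP := hA1 k (fun m => (m == l)%:R) h0 l; rewrite eqxx oner_eq0.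
have hup : \sum_k \sum_l frob2 (blk zs k l A - pi1 (projJ Js k l (blk zs k l A))) <= frob2 (A - P).
  apply: fit_upper => // [k l|i j /AP]; first exact: rank_blk_outer PL.
  by rewrite PL mulf_eq0 negb_or !inE !eqxx.
have [u [v [u1 v1 hlow]]] := fit_lower z J A hpi.
have hop := sum_sqr_blk_form_le z A P a0 (_ : alpha < 1) u1 v1.
have {}hop := hop ltac:(lra).
have hn := noise u v u1 v1.
have hpen := pen_diff sparse b10 b20 zsJ zJ Js0.
have := opt zs Js zsJ; rewrite /objective => hobj.
have cE : card_fam R Js = cardJstar zs Lam by [].
rewrite cE in hpen.
have Fr := frob2B A P.
set Q := \sum_k \sum_l opnorm _ ^+ 2 in hop *.
set S := \sum_k \sum_l blk_form z (A - P) u v k l ^+ 2 in hop hn.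
set G := n%:R * ln K%:R.
have G0 : 0 <= G by rewrite mulr_ge0 // ln_ge0 // ler1n.
have Js_ge0 : 0 <= cardJstar zs Lam by apply: sumr_ge0 => k _; exact: sumr_ge0.
have m_le : #|supp_pairs P z|%:R * expR 1 <= n%:R * K%:R * expR 1 :> R.
  rewrite ler_wpM2r ?expR_ge0 // -natrM ler_nat.
  by apply: leq_trans (max_card _) _; rewrite card_prod !card_ord.
have Xb : cardJbreve P z <= xlog (cardJbreve P z) (n%:R * K%:R * expR 1).
  by rewrite cardJbreveE; exact: xlog_ge_id.
have mb0 : 0 <= cardJbreve P z by rewrite cardJbreveE.
have Xs0 : 0 <= xlog (cardJstar zs Lam) (n%:R * K%:R * expR 1).
  apply: le_trans (xlog_ge_id Js_ge0 _) => //.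
  rewrite ler_wpM2r ?expR_ge0 // -cE.
  apply: le_trans (_ : \sum_(k < K) \sum_(l < K) csize R zs k <= _).
    by apply: ler_sum => k _; apply: ler_sum => l _; exact: card_fam_bound.
  under eq_bigr => k _ do rewrite sumr_const card_ord -[_ *+ _]mulr_natr.
  by rewrite -mulr_suml sum_csize.
have Q0 : 0 <= Q by apply: sumr_ge0 => k _; apply: sumr_ge0 => l _; exact: sqr_ge0.
move: hn hop hobj hlow hup hpen dev0 Fr Xb; rewrite -/G.
set F := frob2 P; set Xs := xlog (cardJstar _ _) _ in Xs0 *.
set Xb := xlog (cardJbreve _ _) _.
set mb := cardJbreve _ _ in mb0 *.
move=> hn hop hobj hlow hup hpen dev0 Fr Xb_ge.
have ia : 0 < alpha^-1 by rewrite invr_gt0.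
(* In the chain fit_lower, optimality, fit_upper, the term [frob2 A] cancels; the lower bound on 2<A
   - P, P> costs [alpha / 4 * F] and [64 / alpha * t]. *)
have key : (1 - alpha / 4) * F <=
    (1 + alpha / 2) * Q + 3 / alpha * (2304 * (mb + G + t)) + 64 / alpha * t + (b1 + b2) * Xs.
  have : 3 / alpha * S <= 3 / alpha * (2304 * (mb + G + t)).
    by rewrite ler_wpM2l // divr_ge0 // ltW.
  by lra.
apply: (absorb_constants a0 a1 t0 G0 Js_ge0 mb0 Q0 Xs0 _ Xb_ge key); lra.
Qed.

(** With [lam = alpha / 32] the quadratic term (alpha^2/256)|P|^2 cancels exactly against the
    threshold, leaving -t. Testing against [- P] gives the lower tail of <A - P, P>. *)
Lemma Prob_inner_dev (R : realType) (n : nat) (P : 'M[R]_n) (alpha t : R) :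
  (forall i j, 0 <= P i j <= 1) -> (forall i j, P i j = P j i) -> 0 < alpha ->
  Prob P (fun a => alpha / 8 * frob2 P + 32 / alpha * t <=
                   inner (Amat R a - P) (- P)) <= expR (- t).
Proof.
move=> P01 Psym a0.
apply: le_trans (noise_tail P01 Psym (- P) _ (_ : 0 <= alpha / 32)) _; first by lra.
rewrite ler_expR.
have -> : frob2 (- P) = frob2 P.
  by apply: eq_bigr => i _; apply: eq_bigr => j _; rewrite mxE sqrrN.
rewrite le_eqVlt; apply/orP; left; apply/eqP; field; by rewrite gt_eqF.
Qed.

Theorem theorem2 (R : realType) (b1 b2 : R) (sparse : bool) :
  0 < b1 -> 0 < b2 ->
  exists H1 H2 : R, 0 < H1 /\ 0 < H2 /\
  forall (n K : nat) (zs : labels n K) (Lam : 'M[R]_(n, K)) (P : 'M[R]_n)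
         (alpha delta t : R)
         (pi1 : 'M[R]_n -> 'M[R]_n) (zhat : 'M[bool]_n -> labels n K),
    (2 <= K)%N ->
    (forall i l, 0 <= Lam i l <= 1) ->
    (forall i j, P i j = Lam i (zs j) * Lam j (zs i)) ->
    A1 zs Lam ->
    best_rank1 pi1 ->
    (forall a : 'M[bool]_n, a^T = a ->
       is_solution pi1 sparse b1 b2 (Amat R a) (zhat a)) ->
    0 < alpha < 1 / 2 -> 0 < delta < 1 -> 0 < t ->
    (forall z : labels n K, delta <= misclass R z zs ->
       (1 + alpha) * (\sum_(k < K) \sum_(l < K) opnorm (blk z k l P) ^+ 2)
       + H1 / alpha * xlog (cardJbreve P z) (n%:R * K%:R * expR 1)
       + H1 / alpha * (cardJstar zs Lam + n%:R * ln K%:R + t)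
       + H2 * xlog (cardJstar zs Lam) (n%:R * K%:R * expR 1)
       <= frob2 P) ->
    1 - 2 * expR (- t) <= Prob P (fun a => misclass R (zhat a) zs <= delta).
Proof.
(* Both constants are those of [absorb_constants], with [b = b1 + b2]. *)
move=> b10 b20; exists 8000, (2 * (b1 + b2)).
split; first by []; split; first by lra.
move=> n K zs Lam P alpha delta t pi1 zhat K2 L01 PL hA1 hpi hz /andP[a0 a1] _ t0 hyp.
have K0 : (0 < K)%N by exact: leq_trans K2.
have P01 i j : 0 <= P i j <= 1.
  have /andP[x0 x1] := L01 i (zs j); have /andP[y0 y1] := L01 j (zs i).
  by rewrite PL mulr_ge0 // mulr_ile1.
have Psym i j : P i j = P j i by rewrite !PL mulrC.
pose good : pred 'M[bool]_n := fun a => misclass R (zhat a) zs <= delta.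
pose bad1 : pred 'M[bool]_n := fun a =>
  alpha / 8 * frob2 P + 32 / alpha * t <= inner (Amat R a - P) (- P).
pose bad2 : pred 'M[bool]_n := fun a => [exists z : labels n K, true && net_exceeds P t z a].
have p1 : Prob P bad1 <= expR (- t) by exact: Prob_inner_dev.
have p2 : Prob P bad2 <= expR (- t) by apply: Prob_net_exceeds => //; exact: ltW.
(* Off both exceptional events, a misclassification above [delta] would put [zhat a] where the
   separation condition holds, against [frob2_lt_of_solution]. *)
have cover a : weight P a != 0 -> ~~ good a -> bad1 a || bad2 a.
  move=> /(weight_supp Psym) [aT aP]; rewrite /good -ltNge => mis.
  apply: contraPT (hyp _ (ltW mis)); rewrite negb_or => /andP[nb1 nb2].
  apply/negP; rewrite -ltNge.
  apply: (frob2_lt_of_solution b10 b20 PL hA1 hpi (hz a aT)) => //.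
  - move=> i j; rewrite mxE; have := aP i j; case: (a i j) => [/(_ isT) //|_].
    by rewrite eqxx.
  - move=> u v u1 v1; apply: sum_blk_form_noise => //; first exact: ltW.
    apply: contra nb2 => nex; apply/existsP; by exists (zhat a).
  move: nb1; rewrite -ltNge.
  have -> : inner (Amat R a - P) (- P) = - inner (Amat R a - P) P.
    rewrite /inner -sumrN; apply: eq_bigr => i _; rewrite -sumrN.
    by apply: eq_bigr => j _; rewrite [(- P) i j]mxE mulrN.
  move: (inner _ _) (frob2 P) => x F; clear; lra.
have total : Prob P good + Prob P (predC good) = 1.
  by rewrite -(weight_sum1 P) [RHS](bigID good).
have : Prob P (predC good) <= Prob P bad1 + Prob P bad2.
  apply: le_trans (Prob_sub P01 cover) _.
  rewrite /Prob (bigID bad1) /=; apply: lerD.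
    rewrite big_mkcond [leRHS]big_mkcond; apply: ler_sum => a _.
    by case: (bad1 a); rewrite ?andbF ?andbT.
  rewrite big_mkcond [leRHS]big_mkcond; apply: ler_sum => a _.
  by case: (bad1 a); case: (bad2 a) => //=; rewrite weight_ge0.
rewrite -/good; lra.
Qed.
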